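(* Let $0<\rho<1$, let $A_\rho=\{\zeta\in\mathbb{C}:\rho<|\zeta|<1\}$, let $r\in(\rho,1)$ be fixed, let $\Gamma=\Gamma_r=\{\zeta\in\mathbb{C}:|\zeta|=r\}$, and let $z\in A_\rho\setminus\Gamma$. Define $$\gamma(z)=\begin{cases}\dfrac{\ln|z|}{\ln r}, & r<|z|<1,\\[2ex] \dfrac{\ln(|z|/\rho)}{\ln(r/\rho)}, & \rho<|z|<r.\end{cases}$$ Then there exists $C>0$ such that for any $\epsilon>0$ and any $f\in H^2(A_\rho)$ with $\|f\|_{H^2(A_\rho)}\le 1$ and $\|f\|_{L^2(\Gamma)}\le\epsilon$ we have $$|f(z)|\le C\epsilon^{\gamma(z)}.$$ Moreover, this bound is asymptotically optimal as $\epsilon\to0$ and is attained by the function $$M(\zeta)=M_\epsilon(\zeta)=\epsilon^{2-\gamma(z)}\sum_{n\in\mathbb{Z}}\frac{(\overline{z}\zeta)^n}{r^{2n}+\epsilon^2(1+\rho^{2n})},\qquad \zeta\in A_\rho,$$ in the following sense: there are constants $c_1,c_2,c_3,c_4,\epsilon_0>0$ (independent of $\epsilon$) such that for all $0<\epsilon<\epsilon_0$: $\|M_\epsilon\|_{H^2(A_\rho)}\le c_1$, $\|M_\epsilon\|_{L^2(\Gamma)}\le c_2\epsilon$, and $c_3\epsilon^{\gamma(z)}\le|M_\epsilon(z)|\le c_4\epsilon^{\gamma(z)}$. In addition, $M_\epsilon$ is analytic in the closure of $A_\rho$ (i.e. it extends analytically to a neighborhood of $\overline{A_\rho}$), and $\|M_\epsilon\|_{H^\infty(\overline{A_\rho})}=\sup_{\zeta\in\overline{A_\rho}}|M_\epsilon(\zeta)|$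 is bounded uniformly in $\epsilon$.
   Context: For a curve $\Gamma\subset\mathbb{C}$, $L^2(\Gamma)$ is the space of square-integrable functions on $\Gamma$ with respect to arc length measure $|d\tau|$. With $\Gamma_s=\{|\zeta|=s\}$, the Hardy space is $$H^2(A_\rho)=\{f\text{ analytic in }A_\rho:\ \|f\|_{H^2(A_\rho)}=\sup_{\rho<s<1}\|f\|_{L^2(\Gamma_s)}<\infty\}.$$ *)

(* Defs.v *)
From Stdlib Require Import Reals ZArith.
From Coquelicot Require Import Coquelicot.
Open Scope R_scope.

Definition circle (s : R) : C -> Prop := fun zeta => Cmod zeta = s.

Definition annulus (rho : R) : C -> Prop := fun zeta => rho < Cmod zeta < 1.

Definition closed_annulus (rho : R) : C -> Prop :=
  fun zeta => rho <= Cmod zeta <= 1.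

(* Complex differentiability: [ex_derive] is taken over the ring [C_AbsRing].
   Only used for open sets [U]. *)
Definition analytic_on (U : C -> Prop) (f : C -> C) : Prop :=
  forall zeta : C, U zeta -> @ex_derive C_AbsRing C_NormedModule f zeta.

(* [s * exp(i t)] *)
Definition circle_point (s t : R) : C := (s * cos t, s * sin t).

(* Norm of [L^2] of the circle of radius [s] for arc length [|dtau| = s dt].
   It is only applied to functions that are continuous on that circle, for
   which the Riemann and Lebesgue integrals agree. *)
Definition L2norm (s : R) (f : C -> C) : R :=
  sqrt (RInt (fun t => (Cmod (f (circle_point s t))) ^ 2 * s) 0 (2 * PI)).

Definition H2norm (rho : R) (f : C -> C) : Rbar :=
  Lub_Rbar (fun x => exists s : R, rho < s < 1 /\ x = L2norm s f).

Definition H2 (rho : R) (f : C -> C) : Prop :=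
  analytic_on (annulus rho) f /\ Rbar_lt (H2norm rho f) p_infty.

Definition sup_norm (K : C -> Prop) (f : C -> C) : Rbar :=
  Lub_Rbar (fun x => exists zeta : C, K zeta /\ x = Cmod (f zeta)).

(* Complex analogue of [powerRZ]. *)
Definition CpowZ (x : C) (n : Z) : C :=
  match n with
  | Z0 => RtoC 1
  | Zpos p => Cpow x (Pos.to_nat p)
  | Zneg p => Cinv (Cpow x (Pos.to_nat p))
  end.

Definition CSeries (a : nat -> C) : C :=
  (Series (fun n => Re (a n)), Series (fun n => Im (a n))).

(* A series over Z converges when its parts [n >= 0] and [n < 0] both do;
   [ZSeries] is its sum, meaningful only in that case. *)
Definition ex_Zseries (a : Z -> C) : Prop :=
  @ex_series C_AbsRing C_NormedModule (fun n : nat => a (Z.of_nat n)) /\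
  @ex_series C_AbsRing C_NormedModule (fun n : nat => a (- Z.of_nat (S n))%Z).

Definition ZSeries (a : Z -> C) : C :=
  Cplus (CSeries (fun n : nat => a (Z.of_nat n)))
        (CSeries (fun n : nat => a (- Z.of_nat (S n))%Z)).

(* The value at [Cmod z = r] is irrelevant. *)
Definition gamma (rho r : R) (z : C) : R :=
  if Rlt_dec r (Cmod z)
  then ln (Cmod z) / ln r
  else ln (Cmod z / rho) / ln (r / rho).

Definition Mterm (rho r : R) (z : C) (eps : R) (zeta : C) (n : Z) : C :=
  Cdiv (CpowZ (Cmult (Cconj z) zeta) n)
       (RtoC (powerRZ r (2 * n) + eps ^ 2 * (1 + powerRZ rho (2 * n)))).

Definition M (rho r : R) (z : C) (eps : R) (zeta : C) : C :=
  Cmult (RtoC (Rpower eps (2 - gamma rho r z)))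
        (ZSeries (Mterm rho r z eps zeta)).

(* Main.v *)
Require Import Defs.
From Stdlib Require Import Reals ZArith Lra Lia Psatz List.
From Stdlib Require Import Classical ClassicalEpsilon FunctionalExtensionality.
From Coquelicot Require Import Coquelicot.
Open Scope R_scope.

(** Write [f = sum a_n zeta^n] and [w_n = r^(2n) + eps^2 (1 + rho^(2n))].
    Parseval on the circles of radius [r], [1] and [rho] gives
    [sum |a_n|^2 w_n <= C eps^2], so by Cauchy-Schwarz [|f z|^2] is at most
    [C eps^2 sum |z|^(2n) / w_n], and the last sum is
    [eps^(gamma - 2) |M z|]. All bounds on [M] reduce to the sums over [n >= 0]
    of [x_n^b / (1 + x_n^2)] with [x_n = q^n / eps] and [0 < b < 2], which are
    bounded uniformly in [eps]; the terms [n < 0] become terms [n > 0] under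
    [(z, zeta, r) -> (rho/z, rho/zeta, rho/r)].

    The Laurent coefficients do not depend on the radius by Goursat's theorem on
    polar rectangles. That the Laurent series converges to [f z] is Chernoff's
    argument: writing [f = f z + (zeta - z) q] the partial sums telescope to
    [f z] plus two Fourier coefficients of [q], which vanish in the limit by
    Bessel's inequality. *)

(** * Complex differentiability *)

(** [gamma] is the exponent with [|z| = r^gamma] if [|z| > r], and with [rho/|z| = (rho/r)^gamma] if
    [|z| < r]. In the first case [x_n = r^n / eps] turns [|z|^(2n) / (r^(2n) + eps^2)] into
    [eps^(2 gamma - 2)] times [x_n^(2 gamma) / (1 + x_n^2)]. The mass sits at the indices where
    [r^n] is close to [eps], and the sum is comparable to one of its terms because
    [0 < 2 gamma < 2]; this is where [|z| <> r] enters.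

    Up to its scalar factor, [M] is the reproducing kernel at [z] for the norm [sum |a_n|^2 w_n],
    which is why it attains the bound.

    The Hardy norm sees only circles inside the annulus, whereas the weights also involve the radii
    [1] and [rho]. Hence the estimates on [f] are made for finite lists of indices: there Bessel's
    inequality suffices, the sums are continuous in the radius, and the two boundary radii are
    reached as limits. *)

Lemma Cmod_le_add (x : C) : Cmod x <= Rabs (Re x) + Rabs (Im x).
Proof.
  destruct x as [a b]; simpl.
  replace (a, b) with (RtoC a + Ci * RtoC b)%C
    by (apply injective_projections; simpl; ring).
  eapply Rle_trans; [apply Cmod_triangle|].
  rewrite Cmod_mult, Cmod_Ci, !Cmod_R; lra.
Qed.

Lemma Im_le_Cmod (x : C) : Rabs (Im x) <= Cmod x.
Proof. eapply Rle_trans; [|apply Rmax_Cmod]; apply Rmax_r. Qed.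

Lemma Cmod_sub_comm (x y : C) : Cmod (x - y) = Cmod (y - x).
Proof. rewrite <- Cmod_opp; f_equal; ring. Qed.

Lemma Cmod_triangle_sub (x y : C) : Cmod x - Cmod y <= Cmod (x - y).
Proof.
  assert (H := Cmod_triangle (x - y) y).
  replace (x - y + y)%C with x in H by ring; lra.
Qed.

(** Measured by [Cmod], which serves both uniform structures on [C]: the one of [C_AbsRing] behind
    [ex_derive] and the product one behind [open]. *)
Definition ccont (f : C -> C) (z : C) : Prop :=
  forall e, 0 < e -> exists d, 0 < d /\
    forall w, Cmod (w - z) < d -> Cmod (f w - f z) < e.

Lemma ccont_const (c z : C) : ccont (fun _ => c) z.
Proof.
  intros e He; exists 1; split; [lra|]; intros w _.
  replace (c - c)%C with (RtoC 0) by ring; now rewrite Cmod_0.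
Qed.

Lemma ccont_id (z : C) : ccont (fun w => w) z.
Proof. intros e He; exists e; split; auto. Qed.

Lemma ccont_ext (f g : C -> C) (z : C) :
  (forall w, f w = g w) -> ccont f z -> ccont g z.
Proof.
  intros E H e He; destruct (H e He) as [d [Hd K]]; exists d; split; auto.
  intros w Hw; rewrite <- !E; auto.
Qed.

Lemma ccont_plus (f g : C -> C) (z : C) :
  ccont f z -> ccont g z -> ccont (fun w => f w + g w)%C z.
Proof.
  intros Hf Hg e He.
  destruct (Hf (e / 2)) as [d1 [Hd1 K1]]; [lra|].
  destruct (Hg (e / 2)) as [d2 [Hd2 K2]]; [lra|].
  exists (Rmin d1 d2); split; [now apply Rmin_glb_lt|]; intros w Hw.
  assert (A1 := K1 w (Rlt_le_trans _ _ _ Hw (Rmin_l _ _))).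
  assert (A2 := K2 w (Rlt_le_trans _ _ _ Hw (Rmin_r _ _))).
  replace (f w + g w - (f z + g z))%C with ((f w - f z) + (g w - g z))%C by ring.
  eapply Rle_lt_trans; [apply Cmod_triangle|lra].
Qed.

Lemma ccont_mult (f g : C -> C) (z : C) :
  ccont f z -> ccont g z -> ccont (fun w => f w * g w)%C z.
Proof.
  intros Hf Hg e He.
  assert (Pf := Cmod_ge_0 (f z)). assert (Pg := Cmod_ge_0 (g z)).
  set (B := Cmod (f z) + Cmod (g z) + 1).
  assert (HB : 0 < B) by (unfold B; lra).
  assert (Heta : 0 < Rmin 1 (e / (B + 1))).
  { apply Rmin_glb_lt; [lra|]; apply Rdiv_lt_0_compat; lra. }
  destruct (Hf _ Heta) as [d1 [Hd1 K1]].
  destruct (Hg _ Heta) as [d2 [Hd2 K2]].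
  exists (Rmin d1 d2); split; [now apply Rmin_glb_lt|]; intros w Hw.
  assert (A1 := K1 w (Rlt_le_trans _ _ _ Hw (Rmin_l _ _))).
  assert (A2 := K2 w (Rlt_le_trans _ _ _ Hw (Rmin_r _ _))).
  assert (M1 := Rmin_l 1 (e / (B + 1))). assert (M2 := Rmin_r 1 (e / (B + 1))).
  set (m := Rmin 1 (e / (B + 1))) in *.
  assert (M3 : m * (B + 1) <= e).
  { apply Rmult_le_reg_r with (/ (B + 1)); [apply Rinv_0_lt_compat; lra|].
    rewrite Rmult_assoc, Rinv_r by lra; lra. }
  replace (f w * g w - f z * g z)%C with
    ((f w - f z) * (g w - g z) + ((f w - f z) * g z + f z * (g w - g z)))%C by ring.
  eapply Rle_lt_trans; [apply Cmod_triangle|].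
  assert (T := Cmod_triangle ((f w - f z) * g z) (f z * (g w - g z))).
  rewrite !Cmod_mult in T; rewrite Cmod_mult.
  assert (U1 := Cmod_ge_0 (f w - f z)). assert (U2 := Cmod_ge_0 (g w - g z)).
  unfold B in *; nra.
Qed.

Lemma ccont_comp (f g : C -> C) (z : C) :
  ccont g z -> ccont f (g z) -> ccont (fun w => f (g w)) z.
Proof.
  intros Hg Hf e He; destruct (Hf e He) as [d [Hd K]].
  destruct (Hg d Hd) as [d' [Hd' K']]; exists d'; split; auto.
Qed.

Lemma ccont_inv (z : C) : z <> 0 -> ccont Cinv z.
Proof.
  intros Hz e He. assert (P := proj1 (Cmod_gt_0 z) Hz).
  set (m := Cmod z) in *.
  exists (Rmin (m / 2) (e * m * m / 2)); split.
  { apply Rmin_glb_lt; [lra|]; assert (0 < e * m * m) by (repeat apply Rmult_lt_0_compat; lra); lra. }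
  intros w Hw.
  assert (W1 := Rlt_le_trans _ _ _ Hw (Rmin_l _ _)).
  assert (W2 := Rlt_le_trans _ _ _ Hw (Rmin_r _ _)).
  assert (V : m / 2 < Cmod w).
  { assert (T := Cmod_triangle_sub z w). rewrite Cmod_sub_comm in T. fold m in T; lra. }
  assert (Hw0 : w <> 0) by (apply Cmod_gt_0; lra).
  replace (/ w - / z)%C with ((z - w) / (w * z))%C by (field; auto).
  rewrite Cmod_div by (now apply Cmult_neq_0).
  rewrite Cmod_mult, Cmod_sub_comm; fold m.
  apply Rmult_lt_reg_r with (Cmod w * m); [apply Rmult_lt_0_compat; lra|].
  unfold Rdiv; rewrite Rmult_assoc, Rinv_l by (apply Rgt_not_eq, Rmult_lt_0_compat; lra).
  assert (0 < e * m) by (apply Rmult_lt_0_compat; lra).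
  nra.
Qed.

(* Caratheodory's form of complex differentiability: the difference quotient
   extends continuously to [z]. *)
Definition cdiff (f : C -> C) (z : C) : Prop :=
  exists q, ccont q z /\ forall w, (f w = f z + (w - z) * q w)%C.

Lemma cdiff_of_eps (f : C -> C) (z l : C) :
  (forall e, 0 < e -> exists d, 0 < d /\ forall w, Cmod (w - z) < d ->
     Cmod (f w - f z - (w - z) * l) <= e * Cmod (w - z)) ->
  cdiff f z.
Proof.
  intros H.
  exists (fun w => if Ceq_dec w z then l else ((f w - f z) / (w - z))%C); split.
  - intros e He; destruct (H (e / 2)) as [d [Hd K]]; [lra|].
    exists d; split; auto; intros w Hw.
    destruct (Ceq_dec z z) as [_|N]; [|now elim N].
    destruct (Ceq_dec w z) as [E|N].
    + replace (l - l)%C with (RtoC 0) by ring; now rewrite Cmod_0.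
    + specialize (K w Hw).
      assert (N' : (w - z)%C <> 0).
      { intro E; apply N; replace w with (w - z + z)%C by ring; rewrite E; ring. }
      assert (P := proj1 (Cmod_gt_0 _) N').
      replace ((f w - f z) / (w - z) - l)%C with
        ((f w - f z - (w - z) * l) / (w - z))%C by (field; auto).
      rewrite Cmod_div by auto.
      apply Rmult_lt_reg_r with (Cmod (w - z)); auto.
      unfold Rdiv; rewrite Rmult_assoc, Rinv_l by lra; nra.
  - intros w; destruct (Ceq_dec w z) as [E|N].
    + rewrite E; ring.
    + field. intro E; apply N; replace w with (w - z + z)%C by ring; rewrite E; ring.
Qed.

Lemma locally_C_eps (z : C) (P : C -> Prop) :
  locally (T := AbsRing_UniformSpace C_AbsRing) z P <->
  exists d, 0 < d /\ forall w, Cmod (w - z) < d -> P w.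
Proof.
  split.
  - intros [d Hd]; exists d; split; [apply cond_pos|]; intros w Hw; apply Hd, Hw.
  - intros [d [Hd K]]; exists (mkposreal d Hd); intros w Hw; apply K, Hw.
Qed.

Lemma ex_derive_cdiff (f : C -> C) (z : C) :
  @ex_derive C_AbsRing C_NormedModule f z <-> cdiff f z.
Proof.
  split.
  - intros [l [_ H]]; apply cdiff_of_eps with l; intros e He.
    specialize (H z (fun P HP => HP) (mkposreal e He)).
    apply locally_C_eps in H; destruct H as [d [Hd K]]; exists d; split; auto.
  - intros [q [Hq E]]; exists (q z); split; [apply is_linear_scal_l|].
    intros x Hx.
    assert (Ex := @is_filter_lim_locally_unique C_AbsRing
      (AbsRing_NormedModule C_AbsRing) z x Hx); subst x.
    intros eps; apply locally_C_eps.
    destruct (Hq eps (cond_pos eps)) as [d [Hd K]]; exists d; split; auto.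
    intros w Hw; specialize (K w Hw).
    change (Cmod (f w - f z - (w - z) * q z) <= eps * Cmod (w - z)).
    rewrite (E w).
    replace (f z + (w - z) * q w - f z - (w - z) * q z)%C
      with ((w - z) * (q w - q z))%C by ring.
    rewrite Cmod_mult. assert (P := Cmod_ge_0 (w - z)). nra.
Qed.

Lemma cdiff_ccont (f : C -> C) (z : C) : cdiff f z -> ccont f z.
Proof.
  intros [q [Hq E]].
  apply ccont_ext with (fun w => f z + (w + - z) * q w)%C; [intro; now rewrite (E w)|].
  apply ccont_plus; [apply ccont_const|]; apply ccont_mult; auto.
  apply ccont_plus; [apply ccont_id|apply ccont_const].
Qed.

Lemma cdiff_ext (f g : C -> C) (z : C) :
  (forall w, f w = g w) -> cdiff f z -> cdiff g z.
Proof.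
  intros E [q [Hq H]]; exists q; split; auto; intros w; rewrite <- !E; auto.
Qed.

Lemma cdiff_const (c z : C) : cdiff (fun _ => c) z.
Proof. exists (fun _ => RtoC 0); split; [apply ccont_const|intros; ring]. Qed.

Lemma cdiff_id (z : C) : cdiff (fun w => w) z.
Proof. exists (fun _ => RtoC 1); split; [apply ccont_const|intros; ring]. Qed.

Lemma cdiff_plus (f g : C -> C) (z : C) :
  cdiff f z -> cdiff g z -> cdiff (fun w => f w + g w)%C z.
Proof.
  intros [p [Hp E]] [q [Hq F]]; exists (fun w => p w + q w)%C; split.
  - now apply ccont_plus.
  - intros w; rewrite (E w), (F w) at 1; ring.
Qed.

Lemma cdiff_mult (f g : C -> C) (z : C) :
  cdiff f z -> cdiff g z -> cdiff (fun w => f w * g w)%C z.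
Proof.
  intros Hf [q [Hq F]]; assert (Cf := cdiff_ccont _ _ Hf).
  destruct Hf as [p [Hp E]].
  exists (fun w => f w * q w + g z * p w)%C; split.
  - apply ccont_plus; apply ccont_mult; auto using ccont_const.
  - intros w; rewrite (F w), (E w) at 1; rewrite (E w); ring.
Qed.

Lemma cdiff_comp (f g : C -> C) (z : C) :
  cdiff g z -> cdiff f (g z) -> cdiff (fun w => f (g w)) z.
Proof.
  intros Hg [p [Hp E]]; assert (Cg := cdiff_ccont _ _ Hg).
  destruct Hg as [q [Hq F]].
  exists (fun w => q w * p (g w))%C; split.
  - apply ccont_mult; auto; now apply ccont_comp.
  - intros w; rewrite (E (g w)), (F w) at 1; ring.
Qed.

Lemma cdiff_inv (z : C) : z <> 0 -> cdiff Cinv z.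
Proof.
  intros Hz; apply cdiff_of_eps with (- / (z * z))%C; intros e He.
  destruct (ccont_inv z Hz (e * Cmod z)) as [d [Hd K]].
  { apply Rmult_lt_0_compat; auto; now apply Cmod_gt_0. }
  assert (P := proj1 (Cmod_gt_0 z) Hz).
  exists (Rmin d (Cmod z)); split; [now apply Rmin_glb_lt|]; intros w Hw.
  specialize (K w (Rlt_le_trans _ _ _ Hw (Rmin_l _ _))).
  assert (W := Rlt_le_trans _ _ _ Hw (Rmin_r _ _)).
  assert (Hw0 : w <> 0).
  { apply Cmod_gt_0. assert (T := Cmod_triangle_sub z w).
    rewrite Cmod_sub_comm in T; lra. }
  replace (/ w - / z - (w - z) * - / (z * z))%C
    with ((w - z) * ((/ w - / z) * - / z))%C by (field; auto).
  rewrite !Cmod_mult, Cmod_opp, Cmod_inv by auto.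
  rewrite Rmult_comm; apply Rmult_le_compat_r; [apply Cmod_ge_0|].
  apply Rmult_le_reg_r with (Cmod z); auto.
  rewrite Rmult_assoc, Rinv_l by lra; lra.
Qed.

(** * Natural and integer powers *)

Lemma cdiff_pow (n : nat) (z : C) : cdiff (fun w => w ^ n)%C z.
Proof.
  induction n as [|n IH]; [exact (cdiff_const 1 z)|].
  apply cdiff_ext with (fun w => w * w ^ n)%C; [reflexivity|].
  apply cdiff_mult; auto using cdiff_id.
Qed.

Lemma cdiff_powZ (n : Z) (z : C) : z <> 0 -> cdiff (fun w => CpowZ w n) z.
Proof.
  intros Hz; destruct n as [|p|p]; simpl.
  - apply cdiff_const.
  - apply cdiff_pow.
  - apply (cdiff_comp Cinv (fun w => w ^ Pos.to_nat p)%C); [apply cdiff_pow|].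
    apply cdiff_inv; now apply Cpow_nz.
Qed.

Lemma CpowZ_of_nat (x : C) (n : nat) : CpowZ x (Z.of_nat n) = (x ^ n)%C.
Proof.
  destruct n as [|n]; [reflexivity|].
  change (CpowZ x (Z.pos (Pos.of_succ_nat n)) = (x ^ S n)%C).
  unfold CpowZ; now rewrite SuccNat2Pos.id_succ.
Qed.

Lemma CpowZ_opp_S (x : C) (n : nat) : CpowZ x (- Z.of_nat (S n)) = (/ x ^ S n)%C.
Proof.
  change (CpowZ x (Z.neg (Pos.of_succ_nat n)) = (/ x ^ S n)%C).
  unfold CpowZ; now rewrite SuccNat2Pos.id_succ.
Qed.

Lemma Z_nat_cases (P : Z -> Prop) :
  (forall n, P (Z.of_nat n)) -> (forall n, P (- Z.of_nat (S n))%Z) -> forall n, P n.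
Proof.
  intros H1 H2 n; destruct (Z_lt_le_dec n 0) as [H|H].
  - replace n with (- Z.of_nat (S (Z.to_nat (- n - 1))))%Z by lia; auto.
  - replace n with (Z.of_nat (Z.to_nat n)) by lia; auto.
Qed.

Lemma CpowZ_succ (x : C) (n : Z) : x <> 0 -> CpowZ x (n + 1) = (x * CpowZ x n)%C.
Proof.
  intros Hx; revert n; apply Z_nat_cases; intros n.
  - replace (Z.of_nat n + 1)%Z with (Z.of_nat (S n)) by lia.
    rewrite !CpowZ_of_nat; apply Cpow_S.
  - destruct n as [|n].
    + rewrite CpowZ_opp_S, Cpow_1_r; change (RtoC 1 = (x * / x)%C); now field.
    + replace (- Z.of_nat (S (S n)) + 1)%Z with (- Z.of_nat (S n))%Z by lia.
      rewrite !CpowZ_opp_S, (Cpow_S x (S n)).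
      field; split; auto; now apply Cpow_nz.
Qed.

(** The step is an equivalence, so that one computation serves both directions away from 0. *)
Lemma Z_succ_ind (P : Z -> Prop) :
  P 0%Z -> (forall n, P n <-> P (n + 1)%Z) -> forall n, P n.
Proof.
  intros H0 HS n; induction n using Z.peano_ind; auto.
  - rewrite <- Z.add_1_r; now apply (proj1 (HS n)).
  - apply (proj2 (HS _)); now replace (Z.pred n + 1)%Z with n by lia.
Qed.

Lemma Cmod_CpowZ (x : C) (n : Z) : x <> 0 -> Cmod (CpowZ x n) = powerRZ (Cmod x) n.
Proof.
  intros Hx; revert n; apply Z_nat_cases; intros n.
  - rewrite CpowZ_of_nat, Cmod_pow, <- pow_powerRZ; reflexivity.
  - rewrite CpowZ_opp_S, Cmod_inv, Cmod_pow by now apply Cpow_nz.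
    now rewrite powerRZ_neg', <- pow_powerRZ.
Qed.

(** * Goursat's theorem on polar rectangles *)

Lemma nested_intervals (u v : nat -> R) :
  (forall n, u n <= u (S n)) -> (forall n, v (S n) <= v n) ->
  (forall n, u n <= v n) -> exists x, forall n, u n <= x <= v n.
Proof.
  intros Hu Hv Huv.
  assert (Mu : forall n m, (n <= m)%nat -> u n <= u m).
  { intros n m H; induction H; [lra|]; specialize (Hu m); lra. }
  assert (Mv : forall n m, (n <= m)%nat -> v m <= v n).
  { intros n m H; induction H; [lra|]; specialize (Hv m); lra. }
  assert (B : forall n m, u n <= v m).
  { intros n m; apply Rle_trans with (u (Nat.max n m)); [apply Mu; lia|].
    apply Rle_trans with (v (Nat.max n m)); [apply Huv|apply Mv; lia]. }
  destruct (completeness (fun x => exists n, x = u n)) as [x [H1 H2]].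
  - exists (v 0%nat); intros y [n ->]; apply B.
  - exists (u 0%nat), 0%nat; reflexivity.
  - exists x; intros n; split; [apply H1; now exists n|].
    apply H2; intros y [m ->]; apply B.
Qed.

(* Cousin's lemma. The cells are all similar to [a,b]x[c,d], so that their area
   controls the square of their diameter. *)
Lemma cousin_rectangle (P : R -> R -> R -> R -> Prop) (a b c d : R) :
  a <= b -> c <= d ->
  (forall x y z u v, a <= x -> x <= y -> y <= z -> z <= b -> c <= u -> u <= v -> v <= d ->
     P x y u v -> P y z u v -> P x z u v) ->
  (forall x y u v w, a <= x -> x <= y -> y <= b -> c <= u -> u <= v -> v <= w -> w <= d ->
     P x y u v -> P x y v w -> P x y u w) ->
  (forall s t, a <= s <= b -> c <= t <= d -> exists delta, 0 < delta /\
     forall x u k, 0 < k <= 1 -> a <= x -> x + (b - a) * k <= b ->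
       c <= u -> u + (d - c) * k <= d ->
       x <= s <= x + (b - a) * k -> u <= t <= u + (d - c) * k ->
       (b - a) * k < delta -> (d - c) * k < delta ->
       P x (x + (b - a) * k) u (u + (d - c) * k)) ->
  P a b c d.
Proof.
  (* If [P] fails on a cell, it fails on one of its four quarters; the bad cells shrink to a point
     at which [Hloc] is violated. *)
  intros Hab Hcd Hs Ht Hloc; apply NNPP; intro Hnot.
  set (h := fun n => (b - a) * (1 / 2) ^ n).
  set (k := fun n => (d - c) * (1 / 2) ^ n).
  assert (Hh : forall n, 0 <= h n).
  { intros n; apply Rmult_le_pos; [lra|]; apply pow_le; lra. }
  assert (Hk : forall n, 0 <= k n).
  { intros n; apply Rmult_le_pos; [lra|]; apply pow_le; lra. }
  assert (Eh : forall n, h n = h (S n) + h (S n)) by (intros; unfold h; simpl; lra).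
  assert (Ek : forall n, k n = k (S n) + k (S n)) by (intros; unfold k; simpl; lra).
  set (Inv := fun n (p : R * R) => a <= fst p /\ fst p + h n <= b /\
     c <= snd p /\ snd p + k n <= d /\ ~ P (fst p) (fst p + h n) (snd p) (snd p + k n)).
  set (Rel := fun n (p q : R * R) =>
     (fst p <= fst q /\ fst q + h (S n) <= fst p + h n) /\
     (snd p <= snd q /\ snd q + k (S n) <= snd p + k n)).
  assert (Step : forall n p, Inv n p -> exists q, Inv (S n) q /\ Rel n p q).
  { intros n [x y] (I1 & I2 & I3 & I4 & I5); simpl in *.
    specialize (Eh n); specialize (Ek n).
    assert (Hh' := Hh (S n)); assert (Hk' := Hk (S n)).
    unfold Inv, Rel.
    destruct (classic (P x (x + h (S n)) y (y + k (S n)))) as [C1|C1];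
      [|exists (x, y); simpl; repeat split; auto; lra].
    destruct (classic (P (x + h (S n)) (x + h n) y (y + k (S n)))) as [C2|C2];
      [|exists (x + h (S n), y); simpl; repeat split; try lra;
        replace (x + h (S n) + h (S n)) with (x + h n) by lra; auto].
    destruct (classic (P x (x + h (S n)) (y + k (S n)) (y + k n))) as [C3|C3];
      [|exists (x, y + k (S n)); simpl; repeat split; try lra;
        replace (y + k (S n) + k (S n)) with (y + k n) by lra; auto].
    destruct (classic (P (x + h (S n)) (x + h n) (y + k (S n)) (y + k n))) as [C4|C4];
      [|exists (x + h (S n), y + k (S n)); simpl; repeat split; try lra;
        replace (y + k (S n) + k (S n)) with (y + k n) by lra;
        replace (x + h (S n) + h (S n)) with (x + h n) by lra; auto].
    elim I5; apply (Ht _ _ _ (y + k (S n))); try lra.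
    - apply (Hs _ (x + h (S n))); auto; lra.
    - apply (Hs _ (x + h (S n))); auto; lra. }
  assert (I0 : Inv 0%nat (a, c)).
  { unfold Inv, h, k; simpl; replace (a + (b - a) * 1) with b by ring.
    replace (c + (d - c) * 1) with d by ring; repeat split; auto; lra. }
  (* Each chosen cell carries its proof of [Inv], without which the next one could not be chosen. *)
  set (next := fun n (s : {p | Inv n p}) =>
    constructive_indefinite_description _ (Step n (proj1_sig s) (proj2_sig s))).
  set (sq := nat_rect (fun n => {p | Inv n p}) (exist _ (a, c) I0)
    (fun n s => exist _ (proj1_sig (next n s)) (proj1 (proj2_sig (next n s))))).
  set (X := fun n => fst (proj1_sig (sq n))).
  set (Y := fun n => snd (proj1_sig (sq n))).
  assert (HR : forall n, Rel n (proj1_sig (sq n)) (proj1_sig (sq (S n)))).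
  { intros n; exact (proj2 (proj2_sig (next n (sq n)))). }
  destruct (nested_intervals X (fun n => X n + h n)) as [s Hsx].
  { intros n; apply (HR n). }
  { intros n; apply (HR n). }
  { intros n; specialize (Hh n); lra. }
  destruct (nested_intervals Y (fun n => Y n + k n)) as [t Hty].
  { intros n; apply (HR n). }
  { intros n; apply (HR n). }
  { intros n; specialize (Hk n); lra. }
  destruct (Hloc s t) as [delta [Hd L]].
  { specialize (Hsx 0%nat); unfold X, h in Hsx; simpl in Hsx; lra. }
  { specialize (Hty 0%nat); unfold Y, k in Hty; simpl in Hty; lra. }
  (* At this depth both sides of the cell are shorter than [delta]; the added 1 keeps the divisor
     positive for degenerate rectangles. *)
  destruct (pow_lt_1_zero (1 / 2) ltac:(rewrite Rabs_right; lra)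
    (delta / (b - a + (d - c) + 1)) ltac:(apply Rdiv_lt_0_compat; lra)) as [n Hn].
  specialize (Hn n (le_n n)).
  assert (Pn : 0 < (1 / 2) ^ n) by (apply pow_lt; lra).
  assert (Pn1 : (1 / 2) ^ n <= 1).
  { assert (Q := pow_incr (1 / 2) 1 n ltac:(lra)); now rewrite pow1 in Q. }
  rewrite Rabs_right in Hn by lra.
  assert (Hn' : (1 / 2) ^ n * (b - a + (d - c) + 1) < delta).
  { apply Rmult_lt_reg_r with (/ (b - a + (d - c) + 1)); [apply Rinv_0_lt_compat; lra|].
    rewrite Rmult_assoc, Rinv_r by lra; lra. }
  destruct (proj2_sig (sq n)) as (J1 & J2 & J3 & J4 & J5).
  apply J5; apply L; auto; try (unfold h, k in *; nra).
  - apply (Hsx n).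
  - apply (Hty n).
Qed.

(** * Complex-valued functions of a real variable *)

Lemma Rcont_eps (f : R -> R) (t : R) :
  continuous f t <-> forall e, 0 < e -> exists d, 0 < d /\
    forall u, Rabs (u - t) < d -> Rabs (f u - f t) < e.
Proof.
  split.
  - intros H e He.
    destruct (proj1 (filterlim_locally f (f t)) H (mkposreal e He)) as [d Hd].
    exists d; split; [apply cond_pos|]; intros u Hu; apply Hd, Hu.
  - intros H; apply (proj2 (filterlim_locally f (f t))); intros e.
    destruct (H e (cond_pos e)) as [d [Hd K]]; exists (mkposreal d Hd).
    intros u Hu; apply K, Hu.
Qed.

Definition pcont (p : R -> C) (t : R) : Prop :=
  continuous (fun u => Re (p u)) t /\ continuous (fun u => Im (p u)) t.

Lemma pcont_comp (f : C -> C) (p : R -> C) (t : R) :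
  ccont f (p t) -> pcont p t -> pcont (fun u => f (p u)) t.
Proof.
  intros Hf [H1 H2].
  assert (H : forall e, 0 < e -> exists d, 0 < d /\
    forall u, Rabs (u - t) < d -> Cmod (f (p u) - f (p t)) < e).
  { intros e He; destruct (Hf e He) as [d [Hd K]].
    destruct (proj1 (Rcont_eps _ _) H1 (d / 2)) as [d1 [Hd1 K1]]; [lra|].
    destruct (proj1 (Rcont_eps _ _) H2 (d / 2)) as [d2 [Hd2 K2]]; [lra|].
    exists (Rmin d1 d2); split; [now apply Rmin_glb_lt|]; intros u Hu.
    apply K; eapply Rle_lt_trans; [apply Cmod_le_add|].
    specialize (K1 u (Rlt_le_trans _ _ _ Hu (Rmin_l _ _))).
    specialize (K2 u (Rlt_le_trans _ _ _ Hu (Rmin_r _ _))).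
    unfold Re, Im in *; simpl; unfold Rminus in *; lra. }
  split; apply Rcont_eps; intros e He; destruct (H e He) as [d [Hd K]];
    exists d; split; auto; intros u Hu; specialize (K u Hu);
    eapply Rle_lt_trans; [| apply K | | apply K].
  - apply (re_le_Cmod (f (p u) - f (p t))).
  - apply (Im_le_Cmod (f (p u) - f (p t))).
Qed.

Lemma pcont_const (c : C) (t : R) : pcont (fun _ => c) t.
Proof. split; apply continuous_const. Qed.

Lemma pcont_plus (f g : R -> C) (t : R) :
  pcont f t -> pcont g t -> pcont (fun u => f u + g u)%C t.
Proof. intros [] []; split; now apply @continuous_plus. Qed.

Lemma pcont_mult (f g : R -> C) (t : R) :
  pcont f t -> pcont g t -> pcont (fun u => f u * g u)%C t.
Proof.
  intros [] []; split; simpl.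
  - apply (continuous_minus (fun u => Re (f u) * Re (g u)) (fun u => Im (f u) * Im (g u)));
      now apply @continuous_mult.
  - apply (continuous_plus (fun u => Re (f u) * Im (g u)) (fun u => Im (f u) * Re (g u)));
      now apply @continuous_mult.
Qed.

Definition is_CI (f : R -> C) (a b : R) (v : C) : Prop :=
  is_RInt (fun t => Re (f t)) a b (Re v) /\ is_RInt (fun t => Im (f t)) a b (Im v).

Definition CI (f : R -> C) (a b : R) : C :=
  (RInt (fun t => Re (f t)) a b, RInt (fun t => Im (f t)) a b).

Lemma CI_unique f a b v : is_CI f a b v -> CI f a b = v.
Proof.
  intros [H1 H2]; apply injective_projections; simpl; now apply is_RInt_unique.
Qed.

Lemma CI_correct f a b : a <= b -> (forall t, a <= t <= b -> pcont f t) ->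
  is_CI f a b (CI f a b).
Proof.
  intros Hab H; split; apply (RInt_correct (V := R_CompleteNormedModule));
    apply (ex_RInt_continuous (V := R_CompleteNormedModule));
    rewrite Rmin_left, Rmax_right by auto; apply H.
Qed.

Lemma is_CI_ext f g a b v : a <= b -> (forall t, a <= t <= b -> f t = g t) ->
  is_CI f a b v -> is_CI g a b v.
Proof.
  intros Hab E [H1 H2]; split; (eapply is_RInt_ext; [|eassumption]);
    rewrite Rmin_left, Rmax_right by auto; intros t Ht; simpl; rewrite E; auto; lra.
Qed.

Lemma is_CI_plus f g a b u v : is_CI f a b u -> is_CI g a b v ->
  is_CI (fun t => f t + g t)%C a b (u + v)%C.
Proof. intros [] []; split; now apply @is_RInt_plus. Qed.

Lemma is_CI_scal (c : C) f a b v : is_CI f a b v ->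
  is_CI (fun t => c * f t)%C a b (c * v)%C.
Proof.
  intros [H1 H2]; split; simpl.
  - apply (is_RInt_minus (V := R_NormedModule)); now apply @is_RInt_scal.
  - apply (is_RInt_plus (V := R_NormedModule)); now apply @is_RInt_scal.
Qed.

Lemma is_CI_minus f g a b u v : is_CI f a b u -> is_CI g a b v ->
  is_CI (fun t => f t - g t)%C a b (u - v)%C.
Proof. intros [] []; split; now apply @is_RInt_minus. Qed.

Lemma is_CI_Chasles f a b c u v : is_CI f a b u -> is_CI f b c v ->
  is_CI f a c (u + v)%C.
Proof. intros [] []; split; eapply @is_RInt_Chasles; eassumption. Qed.

(** The factor 2 comes from bounding the real and the imaginary part separately. *)
Lemma is_CI_le f a b v B : a <= b -> is_CI f a b v ->
  (forall t, a <= t <= b -> Cmod (f t) <= B) -> Cmod v <= 2 * B * (b - a).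
Proof.
  intros Hab [H1 H2] HB.
  eapply Rle_trans; [apply Cmod_le_add|].
  assert (Q1 : Rabs (Re v) <= (b - a) * B).
  { rewrite <- (is_RInt_unique _ _ _ _ H1); apply abs_RInt_le_const; auto.
    - now exists (Re v).
    - intros t Ht; eapply Rle_trans; [apply re_le_Cmod|auto]. }
  assert (Q2 : Rabs (Im v) <= (b - a) * B).
  { rewrite <- (is_RInt_unique _ _ _ _ H2); apply abs_RInt_le_const; auto.
    - now exists (Im v).
    - intros t Ht; eapply Rle_trans; [apply Im_le_Cmod|auto]. }
  lra.
Qed.

Definition pderiv (p : R -> C) (t : R) (l : C) : Prop :=
  is_derive (fun u => Re (p u)) t (Re l) /\ is_derive (fun u => Im (p u)) t (Im l).

Lemma is_CI_derive p p' a b : a <= b ->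
  (forall t, a <= t <= b -> pderiv p t (p' t)) ->
  (forall t, a <= t <= b -> pcont p' t) -> is_CI p' a b (p b - p a)%C.
Proof.
  intros Hab D Hc; split.
  - apply (is_RInt_derive (V := R_CompleteNormedModule) (fun t => Re (p t)) (fun t => Re (p' t)));
      rewrite Rmin_left, Rmax_right by auto; intros t Ht; [apply (D t Ht)|apply (Hc t Ht)].
  - apply (is_RInt_derive (V := R_CompleteNormedModule) (fun t => Im (p t)) (fun t => Im (p' t)));
      rewrite Rmin_left, Rmax_right by auto; intros t Ht; [apply (D t Ht)|apply (Hc t Ht)].
Qed.

Lemma pderiv_plus p q t l m : pderiv p t l -> pderiv q t m ->
  pderiv (fun u => p u + q u)%C t (l + m)%C.
Proof. intros [] []; split; now apply @is_derive_plus. Qed.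

Lemma pderiv_mult p q t l m : pderiv p t l -> pderiv q t m ->
  pderiv (fun u => p u * q u)%C t (l * q t + p t * m)%C.
Proof.
  intros [H1 H2] [H3 H4].
  assert (M : forall (f g : R -> R) f' g', is_derive f t f' -> is_derive g t g' ->
    is_derive (fun u => f u * g u) t (f' * g t + f t * g')).
  { intros f g f' g' Hf Hg; apply (is_derive_mult (K := R_AbsRing) f g); auto.
    intros; apply Rmult_comm. }
  split.
  - refine (eq_rect _ (is_derive _ t)
      (is_derive_minus _ _ _ _ _ (M _ _ _ _ H1 H3) (M _ _ _ _ H2 H4)) _ _).
    simpl; unfold minus, plus, opp; simpl; unfold Re, Im; ring.
  - refine (eq_rect _ (is_derive _ t)
      (is_derive_plus _ _ _ _ _ (M _ _ _ _ H1 H4) (M _ _ _ _ H2 H3)) _ _).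
    simpl; unfold plus; simpl; unfold Re, Im; ring.
Qed.

Lemma pderiv_const c t : pderiv (fun _ => c) t 0.
Proof. split; apply @is_derive_const. Qed.

Lemma pderiv_pcont p t l : pderiv p t l -> pcont p t.
Proof.
  intros [H1 H2]; split.
  - apply (ex_derive_continuous (fun u => Re (p u))); now exists (Re l).
  - apply (ex_derive_continuous (fun u => Im (p u))); now exists (Im l).
Qed.

(** * Polar coordinates and contour integrals *)

Definition unit_circle (t : R) : C := (cos t, sin t).

Lemma pderiv_radius (t s : R) : pderiv (fun u => circle_point u t) s (unit_circle t).
Proof. split; simpl; auto_derive; auto; ring. Qed.

Lemma pderiv_angle (s t : R) :
  pderiv (circle_point s) t (Ci * circle_point s t)%C.
Proof. split; simpl; auto_derive; auto; ring. Qed.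

Lemma Cmod_unit_circle t : Cmod (unit_circle t) = 1.
Proof.
  unfold Cmod, unit_circle; simpl.
  replace (_ + _) with 1; [apply sqrt_1|].
  assert (H := sin2_cos2 t); unfold Rsqr in H; lra.
Qed.

Lemma circle_point_eq s t : circle_point s t = (s * unit_circle t)%C.
Proof. apply injective_projections; simpl; ring. Qed.

Lemma Cmod_circle_point s t : 0 <= s -> Cmod (circle_point s t) = s.
Proof.
  intros Hs; rewrite circle_point_eq, Cmod_mult, Cmod_unit_circle, Cmod_R, Rabs_right; lra.
Qed.

Lemma Rabs_sub_le_deriv (f f' : R -> R) (a b : R) :
  (forall x, is_derive f x (f' x)) -> (forall x, Rabs (f' x) <= 1) ->
  Rabs (f b - f a) <= Rabs (b - a).
Proof.
  intros D B; destruct (MVT_gen f a b f') as [c [_ E]].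
  - intros; apply D.
  - intros x _; apply continuity_pt_filterlim, (ex_derive_continuous f); now exists (f' x).
  - rewrite E, Rabs_mult; specialize (B c); assert (P := Rabs_pos (b - a)); nra.
Qed.

Lemma circle_point_lipschitz s t s0 t0 : 0 <= s0 <= 1 ->
  Cmod (circle_point s t - circle_point s0 t0) <= Rabs (s - s0) + 2 * Rabs (t - t0).
Proof.
  intros Hs.
  replace (circle_point s t - circle_point s0 t0)%C with
    (RtoC (s - s0) * unit_circle t + RtoC s0 * (unit_circle t - unit_circle t0))%C
    by (apply injective_projections; simpl; ring).
  eapply Rle_trans; [apply Cmod_triangle|].
  rewrite !Cmod_mult, !Cmod_R, Cmod_unit_circle, (Rabs_right s0) by lra.
  assert (H : Cmod (unit_circle t - unit_circle t0) <= 2 * Rabs (t - t0)).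
  { eapply Rle_trans; [apply Cmod_le_add|]; simpl.
    assert (H1 : Rabs (cos t - cos t0) <= Rabs (t - t0)).
    { apply Rabs_sub_le_deriv with (fun x => - sin x).
      - intros x; auto_derive; auto; ring.
      - intros x; rewrite Rabs_Ropp; apply Rabs_le, SIN_bound. }
    assert (H2 : Rabs (sin t - sin t0) <= Rabs (t - t0)).
    { apply Rabs_sub_le_deriv with cos.
      - intros x; auto_derive; auto; ring.
      - intros x; apply Rabs_le, COS_bound. }
    unfold Rminus in *; lra. }
  assert (P := Cmod_ge_0 (unit_circle t - unit_circle t0)); nra.
Qed.

(* The two components of the form [K(zeta) dzeta] in polar coordinates. *)
Definition radial_form (K : C -> C) (t s : R) : C :=
  (K (circle_point s t) * unit_circle t)%C.

Definition angular_form (K : C -> C) (s t : R) : C :=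
  (K (circle_point s t) * (Ci * circle_point s t))%C.

(** The integral of [K(zeta) dzeta], counterclockwise around the part of the annulus
    [a <= |zeta| <= b] with angles from [c] to [d]. *)
Definition boundary_integral (K : C -> C) (a b c d : R) : C :=
  (CI (radial_form K c) a b + CI (angular_form K b) c d
   - CI (radial_form K d) a b - CI (angular_form K a) c d)%C.

Section Goursat.

Variables (K : C -> C) (a b : R).
Hypothesis Ha : 0 < a.
Hypothesis Hb : b <= 1.
Hypothesis HK : forall zeta, a <= Cmod zeta <= b -> cdiff K zeta.

Lemma pcont_radial_form (t s : R) : a <= s <= b -> pcont (radial_form K t) s.
Proof.
  intros Hs; apply pcont_mult; [|apply pcont_const].
  apply pcont_comp.
  - apply cdiff_ccont, HK; rewrite Cmod_circle_point; lra.
  - eapply pderiv_pcont, pderiv_radius.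
Qed.

Lemma pcont_angular_form (s t : R) : a <= s <= b -> pcont (angular_form K s) t.
Proof.
  intros Hs; apply pcont_mult.
  - apply pcont_comp.
    + apply cdiff_ccont, HK; rewrite Cmod_circle_point; lra.
    + eapply pderiv_pcont, pderiv_angle.
  - apply pcont_mult; [apply pcont_const|].
    eapply pderiv_pcont, pderiv_angle.
Qed.

Lemma is_CI_radial t x y : a <= x -> x <= y -> y <= b ->
  is_CI (radial_form K t) x y (CI (radial_form K t) x y).
Proof.
  intros; apply CI_correct; auto; intros s Hs; apply pcont_radial_form; lra.
Qed.

Lemma is_CI_angular s u v : a <= s <= b -> u <= v ->
  is_CI (angular_form K s) u v (CI (angular_form K s) u v).
Proof.
  intros; apply CI_correct; auto; intros t Ht; apply pcont_angular_form; lra.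
Qed.

Lemma boundary_integral_split_radius x y z u v :
  a <= x -> x <= y -> y <= z -> z <= b -> u <= v ->
  boundary_integral K x z u v =
  (boundary_integral K x y u v + boundary_integral K y z u v)%C.
Proof.
  intros; unfold boundary_integral.
  rewrite !(CI_unique (radial_form K _) x z _
    (is_CI_Chasles _ _ _ _ _ _ (is_CI_radial _ x y ltac:(lra) ltac:(lra) ltac:(lra))
      (is_CI_radial _ y z ltac:(lra) ltac:(lra) ltac:(lra)))).
  ring.
Qed.

Lemma boundary_integral_split_angle x y u v w :
  a <= x -> x <= y -> y <= b -> u <= v -> v <= w ->
  boundary_integral K x y u w =
  (boundary_integral K x y u v + boundary_integral K x y v w)%C.
Proof.
  intros; unfold boundary_integral.
  rewrite (CI_unique (angular_form K x) u w _
    (is_CI_Chasles _ _ _ _ _ _ (is_CI_angular x u v ltac:(lra) ltac:(lra))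
      (is_CI_angular x v w ltac:(lra) ltac:(lra)))).
  rewrite (CI_unique (angular_form K y) u w _
    (is_CI_Chasles _ _ _ _ _ _ (is_CI_angular y u v ltac:(lra) ltac:(lra))
      (is_CI_angular y v w ltac:(lra) ltac:(lra)))).
  ring.
Qed.

Let primitive (k m : C) (w : C) : C := (k * w + m / 2 * (w * w))%C.

(** An affine integrand has a primitive, so its contributions from the four sides of a cell
    cancel. *)
Lemma is_CI_affine (k m : C) (p p' : R -> C) x y : x <= y ->
  (forall t, x <= t <= y -> pderiv p t (p' t)) ->
  (forall t, x <= t <= y -> pcont p' t) ->
  is_CI (fun t => (k + m * p t) * p' t)%C x y (primitive k m (p y) - primitive k m (p x))%C.
Proof.
  intros Hxy D Hc; unfold primitive.
  apply (is_CI_derive (fun t => k * p t + m / 2 * (p t * p t))%C); auto.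
  - intros t Ht.
    replace ((k + m * p t) * p' t)%C with
      ((0 * p t + k * p' t) + (0 * (p t * p t) + m / 2 * (p' t * p t + p t * p' t)))%C.
    { apply pderiv_plus.
      - apply (pderiv_mult (fun _ => k) p); auto using pderiv_const.
      - apply (pderiv_mult (fun _ => m / 2)%C (fun u => p u * p u)%C);
          [apply pderiv_const|]; apply pderiv_mult; auto. }
    field; intro E; injection E; lra.
  - intros t Ht; assert (Cp := pderiv_pcont _ _ _ (D t Ht)).
    apply pcont_mult; auto; apply pcont_plus; [apply pcont_const|].
    apply pcont_mult; auto using pcont_const.
Qed.

(** Once the tangent affine map of [K] at the base point is removed, the remainder is small compared
    with the diameter of the cell, and it is integrated over a contour whose length is of the order
    of that diameter. *)
Lemma boundary_integral_small (s0 t0 eta : R) : 0 < eta -> a <= s0 <= b ->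
  exists delta, 0 < delta /\ forall x y u v,
    a <= x -> x <= s0 <= y -> y <= b -> u <= t0 <= v ->
    y - x < delta -> v - u < delta ->
    Cmod (boundary_integral K x y u v) <= eta * ((y - x) + (v - u)) ^ 2.
Proof.
  intros Heta Hs0.
  set (z0 := circle_point s0 t0).
  destruct (HK z0) as [q [Hq E]].
  { unfold z0; rewrite Cmod_circle_point; lra. }
  (* Let [D = (y - x) + (v - u)]. The distance to [z0] is at most [2 D], so the remainder is at most
     [eta / 4 * D]. By [is_CI_le] a side of length [L] contributes at most [eta / 2 * D * L], and
     the four lengths add up to [2 D]. With [d / 4] the distance stays below [d]. *)
  destruct (Hq (eta / 8)) as [d [Hd Kd]]; [lra|].
  exists (d / 4); split; [lra|]; intros x y u v Hx Hxy Hy Huv Hdx Hdu.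
  set (k := (K z0 - z0 * q z0)%C). set (m := q z0).
  set (r := fun w => (K w - (k + m * w))%C).
  assert (Er : forall s t, x <= s <= y -> u <= t <= v ->
    Cmod (r (circle_point s t)) <= eta / 4 * ((y - x) + (v - u))).
  { intros s t Hs Ht.
    assert (L := circle_point_lipschitz s t s0 t0 ltac:(lra)); fold z0 in L.
    set (w := circle_point s t) in *.
    assert (B1 : Rabs (s - s0) <= y - x) by (apply Rabs_le; lra).
    assert (B2 : Rabs (t - t0) <= v - u) by (apply Rabs_le; lra).
    assert (Q := Kd w ltac:(lra)).
    replace (r w) with ((w - z0) * (q w - q z0))%C.
    2: { unfold r, k, m; rewrite (E w); ring. }
    rewrite Cmod_mult. assert (P := Cmod_ge_0 (w - z0)).
    assert (P' := Cmod_ge_0 (q w - q z0)).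
    apply Rle_trans with ((2 * ((y - x) + (v - u))) * (eta / 8)); [|lra].
    apply Rmult_le_compat; lra. }
  set (F := primitive k m).
  assert (R1 : forall t, u <= t <= v -> exists w,
    Cmod w <= 2 * (eta / 4 * ((y - x) + (v - u))) * (y - x) /\
    CI (radial_form K t) x y =
      (F (circle_point y t) - F (circle_point x t) + w)%C).
  { intros t Ht.
    assert (I1 := is_CI_radial t x y Hx ltac:(lra) Hy).
    assert (I2 := is_CI_affine k m (fun s => circle_point s t) (fun _ => unit_circle t) x y
      ltac:(lra) ltac:(intros; apply pderiv_radius) ltac:(intros; apply pcont_const)).
    fold F in I2; assert (I3 := is_CI_minus _ _ _ _ _ _ I1 I2).
    eexists; split; [apply (is_CI_le _ x y _ _ ltac:(lra) I3)|ring].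
    intros s Hs; unfold radial_form.
    replace (_ - _)%C with (r (circle_point s t) * unit_circle t)%C by (unfold r; ring).
    rewrite Cmod_mult, Cmod_unit_circle, Rmult_1_r; now apply Er. }
  assert (R2 : forall s, x <= s <= y -> exists w,
    Cmod w <= 2 * (eta / 4 * ((y - x) + (v - u))) * (v - u) /\
    CI (angular_form K s) u v =
      (F (circle_point s v) - F (circle_point s u) + w)%C).
  { intros s Hs.
    assert (I1 := is_CI_angular s u v ltac:(lra) ltac:(lra)).
    assert (I2 := is_CI_affine k m (circle_point s) (fun t => Ci * circle_point s t)%C u v
      ltac:(lra) ltac:(intros; apply pderiv_angle)
      ltac:(intros; apply pcont_mult; [apply pcont_const|eapply pderiv_pcont, pderiv_angle])).
    fold F in I2; assert (I3 := is_CI_minus _ _ _ _ _ _ I1 I2).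
    eexists; split; [apply (is_CI_le _ u v _ _ ltac:(lra) I3)|ring].
    intros t Ht; unfold angular_form.
    replace (_ - _)%C with (r (circle_point s t) * (Ci * circle_point s t))%C
      by (unfold r; ring).
    rewrite !Cmod_mult, Cmod_Ci, Cmod_circle_point by lra.
    specialize (Er s t Hs Ht); assert (P := Cmod_ge_0 (r (circle_point s t))); nra. }
  destruct (R1 u) as [w1 [W1 E1]]; [lra|]. destruct (R1 v) as [w2 [W2 E2]]; [lra|].
  destruct (R2 x) as [w3 [W3 E3]]; [lra|]. destruct (R2 y) as [w4 [W4 E4]]; [lra|].
  unfold boundary_integral; rewrite E1, E2, E3, E4.
  match goal with |- Cmod ?X <= _ => replace X with ((w1 + w4) + (- w2 + - w3))%C by ring end.
  eapply Rle_trans; [apply Cmod_triangle|].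
  assert (T1 := Cmod_triangle w1 w4). assert (T2 := Cmod_triangle (- w2) (- w3)).
  rewrite !Cmod_opp in T2; simpl (_ ^ 2); nra.
Qed.

(** A bound proportional to the area survives gluing of cells, so by [cousin_rectangle] it only has
    to be checked on small cells around each point. *)
Lemma goursat_polar_rectangle (c d : R) : a < b -> c < d ->
  boundary_integral K a b c d = 0.
Proof.
  intros Hab Hcd.
  apply Cmod_eq_0, Rle_antisym; [|apply Cmod_ge_0].
  apply le_epsilon; intros eps Heps; rewrite Rplus_0_l.
  set (D := (b - a) + (d - c)).
  assert (HD : 0 < D) by (unfold D; lra).
  set (area := (b - a) * (d - c)).
  assert (Harea : 0 < area) by (apply Rmult_lt_0_compat; lra).
  set (eta := eps / area).
  assert (Heta : 0 < eta) by (apply Rdiv_lt_0_compat; lra).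
  enough (H : Cmod (boundary_integral K a b c d) <= eta * ((b - a) * (d - c))).
  { eapply Rle_trans; [exact H|]; apply Req_le; unfold eta, area; field; lra. }
  apply (cousin_rectangle (fun x y u v =>
    Cmod (boundary_integral K x y u v) <= eta * ((y - x) * (v - u)))); try lra.
  - intros x y z u v ? ? ? ? ? ? ? P1 P2.
    rewrite (boundary_integral_split_radius x y z) by lra.
    eapply Rle_trans; [apply Cmod_triangle|]; lra.
  - intros x y u v w ? ? ? ? ? ? ? P1 P2.
    rewrite (boundary_integral_split_angle x y u v w) by lra.
    eapply Rle_trans; [apply Cmod_triangle|]; lra.
  - intros s t Hs Ht.
    (* A cell scaled by [k] has area [area * k^2], and its two side lengths add up to [D * k]; the
       ratio [area / D^2] converts one square into the other. *)
    destruct (boundary_integral_small s t (eta * (area / D ^ 2))) as [delta [Hd B]]; auto.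
    { apply Rmult_lt_0_compat; auto; apply Rdiv_lt_0_compat; auto; now apply pow_lt. }
    exists delta; split; auto; intros x u k Hk H1 H2 H3 H4 H5 H6 H7 H8.
    eapply Rle_trans; [apply B; lra|].
    apply Req_le; unfold area; fold D.
    replace (x + (b - a) * k - x + (u + (d - c) * k - u)) with (D * k) by (unfold D; ring).
    field; lra.
Qed.

End Goursat.

Lemma unit_circle_2PI : unit_circle (2 * PI) = unit_circle 0.
Proof. unfold unit_circle; now rewrite cos_2PI, sin_2PI, cos_0, sin_0. Qed.

(** Goursat is applied to [f(w) / w] on the full turn [[0, 2 PI]]. The two radial sides lie on the
    same ray and cancel; on the circular sides [dw / w = i dt]. *)
Lemma circle_integral_constant (f : C -> C) (rho s1 s2 : R) :
  0 < rho -> (forall zeta, annulus rho zeta -> cdiff f zeta) ->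
  rho < s1 < 1 -> rho < s2 < 1 ->
  CI (fun t => f (circle_point s1 t)) 0 (2 * PI) = CI (fun t => f (circle_point s2 t)) 0 (2 * PI).
Proof.
  intros Hrho Hf.
  assert (PP := PI_RGT_0).
  assert (H : forall a b, rho < a -> a < b -> b < 1 ->
    CI (fun t => f (circle_point a t)) 0 (2 * PI) = CI (fun t => f (circle_point b t)) 0 (2 * PI)).
  { intros a b Ha Hab Hb.
    set (K := fun w => (f w * / w)%C).
    assert (HK : forall zeta, a <= Cmod zeta <= b -> cdiff K zeta).
    { intros zeta Hz; apply cdiff_mult; [apply Hf; unfold annulus; lra|].
      apply cdiff_inv, Cmod_gt_0; lra. }
    assert (G := goursat_polar_rectangle K a b ltac:(lra) ltac:(lra) HK 0 (2 * PI) Hab ltac:(lra)).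
    assert (Q : forall s, a <= s <= b ->
      CI (angular_form K s) 0 (2 * PI) = (Ci * CI (fun t => f (circle_point s t)) 0 (2 * PI))%C).
    { intros s Hs; apply CI_unique.
      apply is_CI_ext with (fun t => Ci * f (circle_point s t))%C; [lra| |].
      - intros t _; unfold angular_form, K; field; apply Cmod_gt_0.
        rewrite Cmod_circle_point; lra.
      - apply is_CI_scal, CI_correct; [lra|]; intros t _; apply pcont_comp.
        + apply cdiff_ccont, Hf; unfold annulus; rewrite Cmod_circle_point; lra.
        + eapply pderiv_pcont, pderiv_angle. }
    unfold boundary_integral in G; rewrite !Q in G by lra.
    replace (radial_form K (2 * PI)) with (radial_form K 0) in G.
    2: { apply functional_extensionality; intros s.
         unfold radial_form; now rewrite !circle_point_eq, unit_circle_2PI. }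
    set (X := CI (fun t => f (circle_point a t)) 0 (2 * PI)) in *.
    set (Y := CI (fun t => f (circle_point b t)) 0 (2 * PI)) in *.
    set (Z := CI (radial_form K 0) a b) in *.
    replace X with (Y + Ci * (Z + Ci * Y - Z - Ci * X))%C.
    - rewrite G; ring.
    - replace (Y + Ci * (Z + Ci * Y - Z - Ci * X))%C with (Y + Ci * Ci * (Y - X))%C by ring.
      replace (Ci * Ci)%C with (- (1))%C; [ring|].
      apply injective_projections; simpl; ring. }
  intros H1 H2; destruct (Rtotal_order s1 s2) as [L|[->|L]]; auto.
  - apply H; lra.
  - symmetry; apply H; lra.
Qed.

(** * Fourier and Laurent coefficients *)

Definition expi (n : Z) (t : R) : C := unit_circle (IZR n * t).

Lemma unit_circle_add s t : unit_circle (s + t) = (unit_circle s * unit_circle t)%C.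
Proof.
  unfold unit_circle; rewrite cos_plus, sin_plus.
  apply injective_projections; simpl; ring.
Qed.

Lemma expi_add n m t : expi (n + m) t = (expi n t * expi m t)%C.
Proof. unfold expi; now rewrite <- unit_circle_add, plus_IZR, Rmult_plus_distr_r. Qed.

Lemma expi_0 t : expi 0 t = 1.
Proof. unfold expi, unit_circle; now rewrite Rmult_0_l, cos_0, sin_0. Qed.

Lemma Cconj_expi n t : Cconj (expi n t) = expi (- n) t.
Proof.
  unfold expi, unit_circle, Cconj; simpl.
  rewrite opp_IZR, Ropp_mult_distr_l_reverse, cos_neg, sin_neg; reflexivity.
Qed.

Lemma Cmod_expi n t : Cmod (expi n t) = 1.
Proof. apply Cmod_unit_circle. Qed.

Lemma pderiv_expi n t : pderiv (expi n) t (Ci * IZR n * expi n t)%C.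
Proof. split; simpl; auto_derive; auto; simpl; ring. Qed.

Lemma pcont_expi n t : pcont (expi n) t.
Proof. eapply pderiv_pcont, pderiv_expi. Qed.

Lemma is_CI_const (c : C) a b : is_CI (fun _ => c) a b (RtoC (b - a) * c)%C.
Proof.
  split; simpl.
  - replace ((b - a) * fst c - 0 * snd c) with (scal (b - a) (Re c))
      by (unfold scal; simpl; unfold mult; simpl; unfold Re; ring).
    apply (is_RInt_const (V := R_NormedModule)).
  - replace ((b - a) * snd c + 0 * fst c) with (scal (b - a) (Im c))
      by (unfold scal; simpl; unfold mult; simpl; unfold Im; ring).
    apply (is_RInt_const (V := R_NormedModule)).
Qed.

Lemma is_CI_expi n : is_CI (expi n) 0 (2 * PI) (if Z.eq_dec n 0 then RtoC (2 * PI) else 0).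
Proof.
  assert (PP := PI_RGT_0).
  destruct (Z.eq_dec n 0) as [->|Hn].
  - apply is_CI_ext with (fun _ => RtoC 1); [lra|intros; now rewrite expi_0|].
    replace (RtoC (2 * PI)) with (RtoC (2 * PI - 0) * RtoC 1)%C; [apply is_CI_const|].
    rewrite Rminus_0_r; ring.
  - assert (Hn' : (Ci * IZR n)%C <> 0).
    { apply Cmod_gt_0; rewrite Cmod_mult, Cmod_Ci, Cmod_R, Rmult_1_l.
      apply Rabs_pos_lt, not_0_IZR, Hn. }
    apply is_CI_ext with (fun t => / (Ci * IZR n) * (Ci * IZR n * expi n t))%C;
      [lra|intros; field; auto|].
    1: { split; intro E; apply Hn'; rewrite E; ring. }
    replace (RtoC 0) with (/ (Ci * IZR n) * (expi n (2 * PI) - expi n 0))%C.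
    + apply is_CI_scal, is_CI_derive; [lra|intros; apply pderiv_expi|].
      intros; apply pcont_mult; [apply pcont_const|apply pcont_expi].
    + assert (E : forall k, expi k (2 * PI) = 1).
      { apply Z_succ_ind; [apply expi_0|]; intros k.
        rewrite expi_add; replace (expi 1 (2 * PI)) with (RtoC 1).
        - rewrite Cmult_1_r; tauto.
        - unfold expi; rewrite Rmult_1_l, unit_circle_2PI.
          unfold unit_circle; now rewrite cos_0, sin_0. }
      rewrite E; unfold expi, unit_circle; rewrite Rmult_0_r, cos_0, sin_0.
      change (1, 0) with (RtoC 1); ring.
Qed.

(** Not normalised: [2 PI] times the usual coefficient. *)
Definition fourier (phi : R -> C) (n : Z) : C :=
  CI (fun t => phi t * expi (- n) t)%C 0 (2 * PI).

(** Finite lists keep two-sided convergence out of the estimates on [f]. *)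
Definition sumZ (l : list Z) (u : Z -> R) : R := fold_right (fun n s => u n + s) 0 l.

Lemma sumZ_ext l u v : (forall n, In n l -> u n = v n) -> sumZ l u = sumZ l v.
Proof.
  induction l as [|k l IH]; intros H; simpl; auto.
  rewrite (H k), IH; [reflexivity| |now left]; intros; apply H; now right.
Qed.

Lemma sumZ_le l u v : (forall n, u n <= v n) -> sumZ l u <= sumZ l v.
Proof.
  intros H; induction l as [|k l IH]; simpl; [lra|]; specialize (H k).
  fold (sumZ l u) (sumZ l v); lra.
Qed.

Lemma sumZ_plus l u v : sumZ l (fun n => u n + v n) = sumZ l u + sumZ l v.
Proof. induction l as [|k l IH]; simpl; [ring|]; unfold sumZ in *; rewrite IH; ring. Qed.

Lemma sumZ_scal l c u : sumZ l (fun n => c * u n) = c * sumZ l u.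
Proof. induction l as [|k l IH]; simpl; [ring|]; unfold sumZ in *; rewrite IH; ring. Qed.

Lemma is_CI_fourier phi n : (forall t, pcont phi t) ->
  is_CI (fun t => phi t * expi (- n) t)%C 0 (2 * PI) (fourier phi n).
Proof.
  intros H; assert (PP := PI_RGT_0); apply CI_correct; [lra|].
  intros t _; apply pcont_mult; auto using pcont_expi.
Qed.

Lemma continuous_Cmod_sqr phi t : pcont phi t -> continuous (fun u => Cmod (phi u) ^ 2) t.
Proof.
  intros [H1 H2].
  apply continuous_ext with (fun u => Re (phi u) * Re (phi u) + Im (phi u) * Im (phi u)).
  - intros u; rewrite Cmod2_alt; simpl; ring.
  - apply (continuous_plus (fun u => Re (phi u) * Re (phi u)) (fun u => Im (phi u) * Im (phi u)));
      now apply @continuous_mult.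
Qed.

Lemma ex_RInt_Cmod_sqr phi a b : (forall t, pcont phi t) ->
  ex_RInt (fun t => Cmod (phi t) ^ 2) a b.
Proof.
  intros H; apply (ex_RInt_continuous (V := R_CompleteNormedModule)).
  intros t _; now apply continuous_Cmod_sqr.
Qed.

(** Pythagoras: [m] is the coefficient of the orthogonal projection on [expi k], so the cross term
    is minus twice the square term. *)
Lemma RInt_sub_fourier_mode phi k : (forall t, pcont phi t) ->
  RInt (fun t => Cmod (phi t - fourier phi k / RtoC (2 * PI) * expi k t) ^ 2) 0 (2 * PI) =
  RInt (fun t => Cmod (phi t) ^ 2) 0 (2 * PI) - Cmod (fourier phi k) ^ 2 / (2 * PI).
Proof.
  intros H; assert (PP := PI_RGT_0).
  set (c := fourier phi k). set (m := (c / RtoC (2 * PI))%C).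
  assert (Em : (RtoC (2 * PI) * m)%C = c).
  { unfold m; field; intro E; apply RtoC_inj in E; lra. }
  apply is_RInt_unique.
  destruct (is_CI_scal (2 * Cconj m) _ _ _ _ (is_CI_fourier phi k H)) as [I _].
  fold c in I.
  assert (I0 := RInt_correct _ _ _ (ex_RInt_Cmod_sqr phi 0 (2 * PI) H)).
  set (E := RInt (fun t => Cmod (phi t) ^ 2) 0 (2 * PI)) in *.
  assert (I1 := is_RInt_const (V := R_NormedModule) 0 (2 * PI) (Cmod m ^ 2)).
  assert (I2 := is_RInt_plus _ _ _ _ _ _ (is_RInt_minus _ _ _ _ _ _ I0 I) I1).
  replace (E - Cmod c ^ 2 / (2 * PI)) with
    (plus (minus E (Re (2 * Cconj m * c)%C)) (scal (2 * PI - 0) (Cmod m ^ 2))).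
  - revert I2; apply is_RInt_ext; intros t _.
    assert (U := Cmod_expi k t).
    apply (f_equal (fun x => x ^ 2)) in U; rewrite Cmod2_alt in U.
    rewrite <- Cconj_expi, !Cmod2_alt.
    destruct (expi k t) as [x y]; destruct m as [p q]; destruct (phi t) as [u v].
    unfold minus, plus, opp; simpl in U |- *.
    (* The factor [|expi k t|^2 = 1] is put in so that the integrands agree as polynomials. *)
    replace (p * (p * 1) + q * (q * 1)) with ((p * p + q * q) * (x * (x * 1) + y * (y * 1)))
      by (rewrite U; ring).
    ring.
  - clear I I2 I1 I0; clearbody E m; rewrite <- Em; clear.
    assert (PP := PI_RGT_0).
    rewrite Cmod_mult, Cmod_R, Rabs_right by lra.
    replace (Re (2 * Cconj m * (RtoC (2 * PI) * m))%C) with (4 * PI * Cmod m ^ 2)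
      by (rewrite Cmod2_alt; simpl; unfold Re, Im; ring).
    unfold minus, plus, opp, scal; simpl; unfold mult; simpl.
    field; lra.
Qed.

Lemma fourier_sub_mode phi k n c : (forall t, pcont phi t) -> n <> k ->
  fourier (fun t => phi t - c * expi k t)%C n = fourier phi n.
Proof.
  intros H Hn; assert (PP := PI_RGT_0); apply CI_unique.
  assert (I1 := is_CI_fourier phi n H).
  assert (I2 := is_CI_scal c _ _ _ _ (is_CI_expi (k - n))).
  destruct (Z.eq_dec (k - n) 0) as [E|_]; [lia|].
  assert (I := is_CI_minus _ _ _ _ _ _ I1 I2).
  replace (fourier phi n) with (fourier phi n - c * 0)%C by ring.
  revert I; apply is_CI_ext; [lra|]; intros t _.
  unfold Z.sub; rewrite expi_add; ring.
Qed.

(** The modes are subtracted one at a time. Each subtraction lowers the energy by that mode's share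
    and, by orthogonality, leaves the other coefficients alone; the induction therefore runs over
    all [phi]. *)
Lemma bessel (l : list Z) (phi : R -> C) : NoDup l -> (forall t, pcont phi t) ->
  sumZ l (fun n => Cmod (fourier phi n) ^ 2) <=
  2 * PI * RInt (fun t => Cmod (phi t) ^ 2) 0 (2 * PI).
Proof.
  intros Hl; revert phi; assert (PP := PI_RGT_0).
  induction Hl as [|k l Hk _ IH]; intros phi H; simpl.
  - apply Rmult_le_pos; [lra|]; apply RInt_ge_0; [lra|now apply ex_RInt_Cmod_sqr|].
    intros; apply pow2_ge_0.
  - set (c := (fourier phi k / RtoC (2 * PI))%C).
    specialize (IH (fun t => phi t - c * expi k t)%C).
    unfold c in IH; rewrite RInt_sub_fourier_mode in IH by auto.
    fold c in IH.
    assert (E : sumZ l (fun n => Cmod (fourier (fun t => phi t - c * expi k t)%C n) ^ 2) =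
      sumZ l (fun n => Cmod (fourier phi n) ^ 2)).
    { apply sumZ_ext; intros n Hn; rewrite fourier_sub_mode; auto; now intros ->. }
    rewrite E in IH.
    assert (IH' := IH ltac:(intros t; apply pcont_plus; auto;
      apply (pcont_comp Copp (fun u => c * expi k u)%C);
      [apply cdiff_ccont, (cdiff_ext (fun w => (- (1)) * w)%C); [intros; ring|];
        apply cdiff_mult; [apply cdiff_const|apply cdiff_id]
      |apply pcont_mult; auto using pcont_const, pcont_expi])).
    replace (2 * PI * (RInt (fun t => Cmod (phi t) ^ 2) 0 (2 * PI) -
      Cmod (fourier phi k) ^ 2 / (2 * PI))) with
      (2 * PI * RInt (fun t => Cmod (phi t) ^ 2) 0 (2 * PI) - Cmod (fourier phi k) ^ 2)
      in IH' by (field; lra).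
    simpl in IH' |- *; lra.
Qed.

(** The indices [-N <= n < N], pairing [n] with [-(n + 1)] as the two halves of [ZSeries] do. *)
Fixpoint zlist (N : nat) : list Z :=
  match N with
  | O => nil
  | S N => Z.of_nat N :: (- Z.of_nat (S N))%Z :: zlist N
  end.

Lemma In_zlist N n : In n (zlist N) -> (- Z.of_nat N <= n < Z.of_nat N)%Z.
Proof.
  induction N as [|N IH]; [easy|]; intros [<-|[<-|H]]; try lia.
  specialize (IH H); lia.
Qed.

Lemma NoDup_zlist N : NoDup (zlist N).
Proof.
  induction N as [|N IH]; [constructor|]; simpl; constructor; [|constructor]; auto.
  - intros [H|H]; [lia|apply In_zlist in H; lia].
  - intros H; apply In_zlist in H; lia.
Qed.

Lemma sumZ_zlist_S N u :
  sumZ (zlist (S N)) u = u (Z.of_nat N) + (u (- Z.of_nat (S N))%Z + sumZ (zlist N) u).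
Proof. reflexivity. Qed.

(** By Bessel the squared coefficients, grouped in pairs as in [zlist], form a convergent series, so
    the pairs tend to 0. *)
Lemma riemann_lebesgue phi eta : (forall t, pcont phi t) -> 0 < eta ->
  exists N0, forall N, (N0 <= N)%nat ->
    Cmod (fourier phi (Z.of_nat N)) < eta /\ Cmod (fourier phi (- Z.of_nat (S N))) < eta.
Proof.
  intros H Heta.
  set (u := fun n => Cmod (fourier phi n) ^ 2).
  set (v := fun N => u (Z.of_nat N) + u (- Z.of_nat (S N))%Z).
  assert (Hu : forall n, 0 <= u n) by (intros; apply pow2_ge_0).
  assert (E : forall N, sum_n v N = sumZ (zlist (S N)) u).
  { induction N as [|N IH].
    - rewrite sum_O; unfold v; simpl; lra.
    - rewrite sum_Sn, IH, (sumZ_zlist_S (S N)); unfold plus, v; simpl; lra. }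
  destruct (ex_finite_lim_seq_incr (sum_n v)
    (2 * PI * RInt (fun t => Cmod (phi t) ^ 2) 0 (2 * PI))) as [l Hl].
  - intros N; rewrite sum_Sn; unfold plus; simpl.
    assert (0 <= v (S N)) by (unfold v; specialize (Hu (Z.of_nat (S N))) as A1;
      specialize (Hu (- Z.of_nat (S (S N)))%Z); lra). lra.
  - intros N; rewrite E; exact (bessel (zlist (S N)) phi (NoDup_zlist _) H).
  - assert (L := ex_series_lim_0 v (ex_intro _ l Hl)).
    apply is_lim_seq_spec in L.
    destruct (L (mkposreal (eta ^ 2) (pow_lt _ 2 Heta))) as [N0 K].
    exists N0; intros N HN; specialize (K N HN); simpl in K.
    rewrite Rminus_0_r in K; apply Rabs_lt_between in K.
    unfold v, u in K.
    assert (A1 := Hu (Z.of_nat N)). assert (A2 := Hu (- Z.of_nat (S N))%Z); unfold u in A1, A2.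
    split; apply Rnot_le_lt; intro Cc;
      assert (Q := pow_incr _ _ 2 (conj (Rlt_le _ _ Heta) Cc)); lra.
Qed.

(** * Laurent coefficients and their weighted square sums *)

Lemma CpowZ_circle_point s t n : 0 < s ->
  CpowZ (circle_point s t) n = (RtoC (powerRZ s n) * expi n t)%C.
Proof.
  intros Hs; assert (Hz : circle_point s t <> 0)
    by (apply Cmod_gt_0; rewrite Cmod_circle_point; lra).
  revert n; apply Z_succ_ind.
  - rewrite expi_0; simpl; ring.
  - intros n; rewrite CpowZ_succ, powerRZ_add, expi_add by (auto; lra).
    replace (expi 1 t) with (unit_circle t) by (unfold expi; f_equal; ring).
    rewrite RtoC_mult, powerRZ_1, circle_point_eq.
    assert (Hu : (RtoC s * unit_circle t)%C <> 0) by now rewrite <- circle_point_eq.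
    split; intros E.
    + rewrite E; ring.
    + replace (CpowZ (RtoC s * unit_circle t) n) with
        (/ (RtoC s * unit_circle t) * (RtoC s * unit_circle t * CpowZ (RtoC s * unit_circle t) n))%C
        by (field; split; intro E'; apply Hu; rewrite E'; ring).
      rewrite E; field; split; intro E'; apply Hu; rewrite E'; ring.
Qed.

(* [2 PI] times the [n]-th Laurent coefficient, computed on the circle of radius [s]. *)
Definition laurent (f : C -> C) (s : R) (n : Z) : C :=
  CI (fun t => f (circle_point s t) * CpowZ (circle_point s t) (- n))%C 0 (2 * PI).

Lemma pcont_circle_point f s t : ccont f (circle_point s t) ->
  pcont (fun u => f (circle_point s u)) t.
Proof. intros H; apply pcont_comp; auto; eapply pderiv_pcont, pderiv_angle. Qed.

Lemma is_CI_laurent f s n : 0 < s -> (forall t, ccont f (circle_point s t)) ->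
  is_CI (fun t => f (circle_point s t) * CpowZ (circle_point s t) (- n))%C 0 (2 * PI)
    (laurent f s n).
Proof.
  intros Hs H; assert (PP := PI_RGT_0); apply CI_correct; [lra|]; intros t _.
  apply pcont_mult; [now apply pcont_circle_point|].
  apply (pcont_circle_point (fun w => CpowZ w (- n))), cdiff_ccont, cdiff_powZ.
  apply Cmod_gt_0; rewrite Cmod_circle_point; lra.
Qed.

Lemma fourier_laurent f s n : 0 < s -> (forall t, ccont f (circle_point s t)) ->
  fourier (fun t => f (circle_point s t)) n = (RtoC (powerRZ s n) * laurent f s n)%C.
Proof.
  intros Hs H; assert (PP := PI_RGT_0); apply CI_unique.
  generalize (is_CI_scal (RtoC (powerRZ s n)) _ _ _ _ (is_CI_laurent f s n Hs H)).
  apply is_CI_ext; [lra|]; intros t _.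
  rewrite CpowZ_circle_point by auto.
  transitivity (RtoC (powerRZ s n * powerRZ s (- n)) * (f (circle_point s t) * expi (- n) t))%C.
  - rewrite RtoC_mult; ring.
  - rewrite <- powerRZ_add by lra; rewrite Z.add_opp_diag_r; simpl; ring.
Qed.

Lemma laurent_radius f rho s1 s2 n : 0 < rho ->
  (forall zeta, annulus rho zeta -> cdiff f zeta) -> rho < s1 < 1 -> rho < s2 < 1 ->
  laurent f s1 n = laurent f s2 n.
Proof.
  intros Hrho Hf H1 H2.
  apply (circle_integral_constant (fun w => f w * CpowZ w (- n))%C rho); auto.
  intros zeta Hz; apply cdiff_mult; auto.
  apply cdiff_powZ, Cmod_gt_0; destruct Hz; lra.
Qed.

Lemma RInt_sqr_le_of_L2norm s f B : 0 < s -> L2norm s f <= B ->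
  (forall t, ccont f (circle_point s t)) ->
  RInt (fun t => Cmod (f (circle_point s t)) ^ 2) 0 (2 * PI) <= B ^ 2 / s.
Proof.
  intros Hs H Hf; unfold L2norm in H.
  assert (PP := PI_RGT_0).
  assert (E := ex_RInt_Cmod_sqr (fun t => f (circle_point s t)) 0 (2 * PI)
    (fun t => pcont_circle_point f s t (Hf t))).
  assert (I := is_RInt_scal _ _ _ s _ (RInt_correct _ _ _ E)).
  set (X := RInt (fun t => Cmod (f (circle_point s t)) ^ 2) 0 (2 * PI)) in *.
  rewrite (is_RInt_unique _ 0 (2 * PI) (s * X)) in H.
  2: { revert I; apply is_RInt_ext; intros t _; apply Rmult_comm. }
  assert (HX : 0 <= X).
  { apply RInt_ge_0; [lra|exact E|]; intros; apply pow2_ge_0. }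
  assert (Q : s * X <= B ^ 2).
  { rewrite <- (sqrt_sqrt (s * X)) by (apply Rmult_le_pos; lra).
    assert (P := sqrt_pos (s * X)); nra. }
  apply Rmult_le_reg_l with s; auto.
  replace (s * (B ^ 2 / s)) with (B ^ 2) by (field; lra); auto.
Qed.

Lemma powerRZ_double x n : powerRZ x (2 * n) = powerRZ x n ^ 2.
Proof.
  rewrite <- Z.add_diag; revert n; apply Z_nat_cases; intros n.
  - replace (Z.of_nat n + Z.of_nat n)%Z with (Z.of_nat (n + n)) by lia.
    rewrite <- !pow_powerRZ, pow_add; ring.
  - replace (- Z.of_nat (S n) + - Z.of_nat (S n))%Z with (- Z.of_nat (S n + S n))%Z by lia.
    rewrite !powerRZ_neg', <- !pow_powerRZ, pow_add, Rinv_mult; ring.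
Qed.

Lemma sumZ_laurent_le f s l B : 0 < s -> NoDup l -> L2norm s f <= B ->
  (forall t, ccont f (circle_point s t)) ->
  sumZ l (fun n => Cmod (laurent f s n) ^ 2 * powerRZ s (2 * n)) <= 2 * PI * (B ^ 2 / s).
Proof.
  intros Hs Hl HB Hf; assert (PP := PI_RGT_0).
  rewrite (sumZ_ext _ _ (fun n => Cmod (fourier (fun t => f (circle_point s t)) n) ^ 2)).
  - eapply Rle_trans; [apply bessel; auto; intros; now apply pcont_circle_point|].
    apply Rmult_le_compat_l; [lra|]; now apply RInt_sqr_le_of_L2norm.
  - intros n _; rewrite fourier_laurent, Cmod_mult, Cmod_R, powerRZ_double by auto.
    rewrite Rpow_mult_distr, <- (pow2_abs (powerRZ s n)); ring.
Qed.

Lemma continuous_powerRZ n s : 0 < s -> continuous (fun x => powerRZ x n) s.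
Proof.
  intros Hs.
  apply (continuous_ext_loc _ (fun x => Rpower x (IZR n))).
  - exists (mkposreal s Hs); intros x Hx; symmetry; apply powerRZ_Rpower.
    change (Rabs (x - s) < s) in Hx; apply Rabs_lt_between in Hx; lra.
  - apply (ex_derive_continuous (fun x => Rpower x (IZR n))).
    unfold Rpower; auto_derive; auto.
Qed.

Lemma continuous_sumZ l k s : 0 < s ->
  continuous (fun x => sumZ l (fun n => k n * powerRZ x (2 * n))) s.
Proof.
  intros Hs; induction l as [|n l IH].
  - apply continuous_const.
  - apply (continuous_plus (fun x => k n * powerRZ x (2 * n))); auto.
    apply (continuous_mult (fun _ => k n)); [apply continuous_const|].
    now apply continuous_powerRZ.
Qed.

Lemma continuous_le_limit (h : R -> R) (x B : R) : continuous h x ->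
  (forall d, 0 < d -> exists y, Rabs (y - x) < d /\ h y <= B) -> h x <= B.
Proof.
  intros Hc H; apply le_epsilon; intros e He.
  destruct (proj1 (Rcont_eps h x) Hc e He) as [d [Hd K]].
  destruct (H d Hd) as [y [Hy Hb]]; specialize (K y Hy).
  apply Rabs_lt_between in K; lra.
Qed.

(** Since the coefficients do not depend on the radius, the finite sum [h] is a continuous function
    of it, and its bound extends to the radii [1] and [rho]. The three parts of the weight cost
    [2 PI / rho * eps^2] each; [1 / rho] bounds the factor [1 / s] left by arc length. *)
Lemma sumZ_laurent_weighted_le f rho r l eps :
  0 < rho < 1 -> rho < r < 1 -> NoDup l ->
  (forall zeta, annulus rho zeta -> cdiff f zeta) ->
  (forall s, rho < s < 1 -> L2norm s f <= 1) -> L2norm r f <= eps ->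
  sumZ l (fun n => Cmod (laurent f r n) ^ 2 *
    (powerRZ r (2 * n) + eps ^ 2 * (1 + powerRZ rho (2 * n)))) <= 6 * PI / rho * eps ^ 2.
Proof.
  intros Hrho Hr Hl Hf H1 Heps; assert (PP := PI_RGT_0).
  assert (Hc : forall s, rho < s < 1 -> forall t, ccont f (circle_point s t)).
  { intros s Hs t; apply cdiff_ccont, Hf; unfold annulus.
    rewrite Cmod_circle_point; lra. }
  set (k := fun n => Cmod (laurent f r n) ^ 2).
  set (h := fun s => sumZ l (fun n => k n * powerRZ s (2 * n))).
  assert (Hh : forall s B, rho < s < 1 -> L2norm s f <= B -> h s <= 2 * PI / rho * B ^ 2).
  { intros s B Hs HB; unfold h, k.
    rewrite (sumZ_ext _ _ (fun n => Cmod (laurent f s n) ^ 2 * powerRZ s (2 * n))).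
    - eapply Rle_trans; [apply (sumZ_laurent_le f s l B); auto; try lra|].
      replace (2 * PI / rho * B ^ 2) with (2 * PI * (B ^ 2 * / rho)) by (field; lra).
      apply Rmult_le_compat_l; [lra|]; apply Rmult_le_compat_l; [apply pow2_ge_0|].
      apply Rinv_le_contravar; lra.
    - intros n _; now rewrite (laurent_radius f rho r s) by (auto; lra). }
  assert (E1 : h 1 <= 2 * PI / rho * 1 ^ 2).
  { apply continuous_le_limit; [apply continuous_sumZ; lra|]; intros d Hd.
    exists (1 - Rmin (d / 2) ((1 - rho) / 2)).
    assert (M1 := Rmin_l (d / 2) ((1 - rho) / 2)). assert (M2 := Rmin_r (d / 2) ((1 - rho) / 2)).
    assert (M3 : 0 < Rmin (d / 2) ((1 - rho) / 2)) by (apply Rmin_glb_lt; lra).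
    split; [apply Rabs_lt_between; lra|]; apply Hh; [lra|]; apply H1; lra. }
  assert (E2 : h rho <= 2 * PI / rho * 1 ^ 2).
  { apply continuous_le_limit; [apply continuous_sumZ; lra|]; intros d Hd.
    exists (rho + Rmin (d / 2) ((1 - rho) / 2)).
    assert (M1 := Rmin_l (d / 2) ((1 - rho) / 2)). assert (M2 := Rmin_r (d / 2) ((1 - rho) / 2)).
    assert (M3 : 0 < Rmin (d / 2) ((1 - rho) / 2)) by (apply Rmin_glb_lt; lra).
    split; [apply Rabs_lt_between; lra|]; apply Hh; [lra|]; apply H1; lra. }
  assert (E3 := Hh r eps Hr Heps).
  rewrite (sumZ_ext _ _ (fun n => k n * powerRZ r (2 * n) +
    eps ^ 2 * (k n * powerRZ 1 (2 * n) + k n * powerRZ rho (2 * n)))).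
  - rewrite sumZ_plus, sumZ_scal, sumZ_plus; fold (h r) (h 1) (h rho).
    assert (Q := pow2_ge_0 eps).
    replace (6 * PI / rho) with (3 * (2 * PI / rho)) by (field; lra).
    rewrite pow1 in *; nra.
  - intros n _; unfold k; rewrite powerRZ_R1; ring.
Qed.

(** * Convergence of the Laurent series at a point *)

Definition csumZ (l : list Z) (u : Z -> C) : C := fold_right (fun n s => u n + s)%C 0 l.

Lemma Cmod_csumZ_le l u : Cmod (csumZ l u) <= sumZ l (fun n => Cmod (u n)).
Proof.
  induction l as [|n l IH]; simpl; [rewrite Cmod_0; lra|].
  eapply Rle_trans; [apply Cmod_triangle|]; unfold csumZ, sumZ in *; lra.
Qed.

Lemma ccont_ext_loc (f g : C -> C) (z : C) (d : R) : 0 < d ->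
  (forall w, Cmod (w - z) < d -> f w = g w) -> ccont f z -> ccont g z.
Proof.
  intros Hd E H e He; destruct (H e He) as [d' [Hd' K]].
  exists (Rmin d d'); split; [now apply Rmin_glb_lt|]; intros w Hw.
  assert (W1 := Rlt_le_trans _ _ _ Hw (Rmin_l _ _)).
  assert (W2 := Rlt_le_trans _ _ _ Hw (Rmin_r _ _)).
  rewrite <- (E w W1), <- (E z); auto.
  replace (z - z)%C with (RtoC 0) by ring; now rewrite Cmod_0.
Qed.

(** Away from [z] the equation determines [q] as a quotient of continuous functions; at [z] its
    continuity is the differentiability of [f]. *)
Lemma difference_quotient_ccont f q z w :
  (forall w, f w = f z + (w - z) * q w)%C -> ccont q z -> cdiff f w -> ccont q w.
Proof.
  intros E Hq Hf; destruct (Ceq_dec w z) as [->|N]; auto.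
  assert (Hd : 0 < Cmod (w - z)).
  { apply Cmod_gt_0; intro E0; apply N; replace w with (w - z + z)%C by ring; rewrite E0; ring. }
  apply ccont_ext_loc with (fun x => (f x + - f z) * / (x + - z))%C (Cmod (w - z)); auto.
  - intros x Hx; rewrite (E x); field.
    intro E0; replace (w - z)%C with (- (x - w))%C in Hx.
    + rewrite Cmod_opp in Hx; lra.
    + replace w with (w - z + z)%C at 2 by ring.
      replace x with (x + - z + z)%C by ring; rewrite E0; ring.
  - apply ccont_mult.
    + apply ccont_plus; [now apply cdiff_ccont|apply ccont_const].
    + apply (ccont_comp Cinv (fun x => x + - z)%C).
      * apply ccont_plus; [apply ccont_id|apply ccont_const].
      * apply ccont_inv; now apply Cmod_gt_0.
Qed.

(* Multiplication by [w - z] telescopes the partial Laurent sums at [z], so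
   that only two coefficients of the difference quotient at [z] remain. *)
Lemma laurent_partial_sum f rho z eta :
  0 < rho < 1 -> annulus rho z -> (forall zeta, annulus rho zeta -> cdiff f zeta) -> 0 < eta ->
  exists N, 2 * PI * Cmod (f z) <=
    eta + sumZ (zlist N) (fun n => Cmod (laurent f (Cmod z) n) * powerRZ (Cmod z) n).
Proof.
  intros Hrho Hz Hf Heta; assert (PP := PI_RGT_0).
  set (s := Cmod z).
  assert (Hs : rho < s < 1) by exact Hz.
  destruct (Hf z Hz) as [q [Hq E]].
  assert (Hann : forall t, annulus rho (circle_point s t)).
  { intros t; unfold annulus; rewrite Cmod_circle_point; lra. }
  assert (Cq : forall t, ccont q (circle_point s t)).
  { intros t; apply (difference_quotient_ccont f q z); auto. }
  assert (Hz0 : z <> 0) by (apply Cmod_gt_0; fold s; lra).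
  assert (Hc0 : forall t, circle_point s t <> 0).
  { intros t; apply Cmod_gt_0; rewrite Cmod_circle_point; lra. }
  set (G := fun n => (laurent q s n * CpowZ z (n + 1))%C).
  set (delta := fun n : Z => if Z.eq_dec n 0 then (RtoC (2 * PI) * f z)%C else RtoC 0).
  assert (Term : forall n, (laurent f s n * CpowZ z n = delta n + (G (n - 1)%Z - G n))%C).
  { intros n.
    (* In [f w = f z + (w - z) q w], the constant contributes to index 0 only, and the factor [w]
       shifts the index of the coefficients of [q] by one. *)
    assert (L : laurent f s n = (RtoC (powerRZ s (- n)) * f z *
      (if Z.eq_dec (- n) 0 then RtoC (2 * PI) else 0) +
      (laurent q s (n - 1) - z * laurent q s n))%C).
    { apply CI_unique.
      generalize (is_CI_plus _ _ _ _ _ _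
        (is_CI_scal (RtoC (powerRZ s (- n)) * f z) _ _ _ _ (is_CI_expi (- n)))
        (is_CI_minus _ _ _ _ _ _ (is_CI_laurent q s (n - 1) ltac:(lra) Cq)
          (is_CI_scal z _ _ _ _ (is_CI_laurent q s n ltac:(lra) Cq)))).
      apply is_CI_ext; [lra|]; intros t _.
      replace (- (n - 1))%Z with (- n + 1)%Z by ring.
      rewrite CpowZ_succ, (E (circle_point s t)) by auto.
      rewrite (CpowZ_circle_point s t (- n)) by lra; ring. }
    rewrite L; unfold G, delta.
    replace (n - 1 + 1)%Z with n by ring; rewrite CpowZ_succ by auto.
    destruct (Z.eq_dec n 0) as [->|N]; destruct (Z.eq_dec (- _) 0) as [E0|E0]; try lia.
    - simpl; ring.
    - ring. }
  assert (Sum : forall N, csumZ (zlist (S N)) (fun n => laurent f s n * CpowZ z n)%C =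
    (RtoC (2 * PI) * f z + G (- Z.of_nat (S (S N)))%Z - G (Z.of_nat N))%C).
  { induction N as [|N IH].
    - unfold zlist, csumZ; cbn [fold_right]; rewrite !Term; unfold delta; simpl; ring.
    - change (csumZ (zlist (S (S N))) (fun n => laurent f s n * CpowZ z n)%C) with
        (laurent f s (Z.of_nat (S N)) * CpowZ z (Z.of_nat (S N)) +
         (laurent f s (- Z.of_nat (S (S N))) * CpowZ z (- Z.of_nat (S (S N))) +
          csumZ (zlist (S N)) (fun n => laurent f s n * CpowZ z n)))%C.
      rewrite IH, !Term; unfold delta.
      destruct (Z.eq_dec _ 0); [lia|]; destruct (Z.eq_dec _ 0); [lia|].
      replace (Z.of_nat (S N) - 1)%Z with (Z.of_nat N) by lia.
      replace (- Z.of_nat (S (S N)) - 1)%Z with (- Z.of_nat (S (S (S N))))%Z by lia.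
      ring. }
  destruct (riemann_lebesgue (fun t => q (circle_point s t)) (eta / 2)) as [N0 RL].
  { intros t; now apply pcont_circle_point. }
  { lra. }
  (* The two sides differ by a factor [s], which is less than 1. *)
  assert (GF : forall n, Cmod (G n) <= Cmod (fourier (fun t => q (circle_point s t)) n)).
  { intros n; unfold G; rewrite fourier_laurent by (auto; lra).
    rewrite !Cmod_mult, Cmod_CpowZ, Cmod_R by auto; fold s.
    rewrite Rabs_right by (apply Rle_ge, powerRZ_le; lra).
    rewrite powerRZ_add, powerRZ_1 by lra.
    assert (P1 := Cmod_ge_0 (laurent q s n)).
    assert (P2 : 0 <= powerRZ s n) by (apply powerRZ_le; lra).
    assert (0 <= Cmod (laurent q s n) * powerRZ s n) by now apply Rmult_le_pos.
    nra. }
  (* The indices run from [-(N0 + 1)] to [N0], so telescoping leaves [G] at [N0] and at [-(N0 + 2)];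
     the latter is the negative member of the pair with index [S N0]. *)
  exists (S N0).
  destruct (RL N0 (le_n _)) as [B1 _]. destruct (RL (S N0) (le_S _ _ (le_n _))) as [_ B2].
  assert (C1 := GF (Z.of_nat N0)). assert (C2 := GF (- Z.of_nat (S (S N0)))%Z).
  specialize (Sum N0).
  assert (T := Cmod_csumZ_le (zlist (S N0)) (fun n => laurent f s n * CpowZ z n)%C).
  rewrite (sumZ_ext _ _ (fun n => Cmod (laurent f s n) * powerRZ s n)) in T.
  2: { intros n _; now rewrite Cmod_mult, Cmod_CpowZ. }
  set (X := csumZ _ _) in *.
  assert (F : (RtoC (2 * PI) * f z = X + (G (Z.of_nat N0) + - G (- Z.of_nat (S (S N0)))%Z))%C).
  { rewrite Sum; ring. }
  apply (f_equal Cmod) in F.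
  rewrite Cmod_mult, Cmod_R, Rabs_right in F by lra; rewrite F.
  eapply Rle_trans; [apply Cmod_triangle|].
  assert (T2 := Cmod_triangle (G (Z.of_nat N0)) (- G (- Z.of_nat (S (S N0)))%Z)).
  rewrite Cmod_opp in T2; lra.
Qed.

(** * Bounds for the kernel sums *)

Lemma Rpower_gt_0 x y : 0 < Rpower x y.
Proof. apply exp_pos. Qed.

Lemma Rpower_pow_swap q b n : 0 < q -> Rpower q b ^ n = Rpower (q ^ n) b.
Proof.
  intros Hq; rewrite <- Rpower_pow, <- (Rpower_pow n q) by (auto; apply Rpower_gt_0).
  rewrite !Rpower_mult; f_equal; ring.
Qed.

Lemma Rpower_1_l b : Rpower 1 b = 1.
Proof. unfold Rpower; now rewrite ln_1, Rmult_0_r, exp_0. Qed.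

Lemma Rpower_le_exponent_small x a b : 0 < x <= 1 -> a <= b -> Rpower x b <= Rpower x a.
Proof.
  intros [Hx Hx1] Hab; unfold Rpower.
  assert (L : ln x <= 0) by (rewrite <- ln_1; apply ln_le; lra).
  destruct (Req_dec (b * ln x) (a * ln x)) as [->|N]; [lra|].
  apply Rlt_le, exp_increasing; nra.
Qed.

Lemma Rpower_le_exponent_large x a b : 1 <= x -> a <= b -> Rpower x a <= Rpower x b.
Proof.
  intros Hx Hab; unfold Rpower.
  assert (L : 0 <= ln x) by (rewrite <- ln_1; apply ln_le; lra).
  destruct (Req_dec (a * ln x) (b * ln x)) as [->|N]; [lra|].
  apply Rlt_le, exp_increasing; nra.
Qed.

Lemma Rpower_le_base x y b : 0 < x <= y -> 0 <= b -> Rpower x b <= Rpower y b.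
Proof. intros; now apply Rle_Rpower_l. Qed.

Lemma Rpower_two x : 0 < x -> Rpower x 2 = x ^ 2.
Proof. intros; rewrite <- Rpower_pow by auto; f_equal; simpl; ring. Qed.

Lemma sum_n_le_telescope (u phi : nat -> R) (K : R) (N : nat) : 0 <= K ->
  (forall n, 0 <= phi n) -> phi 0%nat <= 1 ->
  (forall n, u n <= K * (phi n - phi (S n))) -> sum_n u N <= K.
Proof.
  intros HK Hphi H0 Hu.
  assert (H : sum_n u N <= K * (phi 0%nat - phi (S N))).
  { induction N as [|N IH]; [rewrite sum_O; apply Hu|].
    rewrite sum_Sn; unfold plus; simpl; specialize (Hu (S N)); lra. }
  specialize (Hphi (S N)); nra.
Qed.

(** The right side behaves like [x^a] near 0 and like [x^(-a)] at infinity. For [x <= 1] the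
    comparison needs [a <= b], for [x > 1] it needs [a + b <= 2]. *)
Lemma power_kernel_le x b a : 0 < x -> 0 <= a -> a <= b -> a <= 2 - b ->
  Rpower x b / (1 + x ^ 2) <= 4 * (Rpower x a / (1 + Rpower x a) ^ 2).
Proof.
  intros Hx Ha Hab Hab2.
  set (y := Rpower x a). assert (Hy : 0 < y) by apply Rpower_gt_0.
  assert (Hx2 : 0 < x ^ 2) by (apply pow_lt; auto).
  assert (Hy2 : 0 < (1 + y) ^ 2) by (apply pow_lt; lra).
  assert (Hb := Rpower_gt_0 x b).
  apply Rmult_le_reg_r with ((1 + x ^ 2) * (1 + y) ^ 2); [apply Rmult_lt_0_compat; lra|].
  replace (Rpower x b / (1 + x ^ 2) * ((1 + x ^ 2) * (1 + y) ^ 2))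
    with (Rpower x b * (1 + y) ^ 2) by (field; lra).
  replace (4 * (y / (1 + y) ^ 2) * ((1 + x ^ 2) * (1 + y) ^ 2))
    with (4 * y * (1 + x ^ 2)) by (field; lra).
  destruct (Rle_dec x 1) as [L|L].
  - assert (B1 : Rpower x b <= y) by (apply Rpower_le_exponent_small; lra).
    assert (B2 : y <= 1).
    { unfold y; rewrite <- (Rpower_1_l a); apply Rpower_le_base; lra. }
    assert ((1 + y) ^ 2 <= 4) by nra. nra.
  - assert (B1 : Rpower x b * y <= x ^ 2).
    { unfold y; rewrite <- Rpower_plus, <- Rpower_two by auto.
      apply Rpower_le_exponent_large; lra. }
    assert (B2 : 1 <= y).
    { unfold y; rewrite <- (Rpower_1_l a); apply Rpower_le_base; lra. }
    assert ((1 + y) ^ 2 <= 4 * y * y) by nra.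
    apply Rle_trans with (Rpower x b * (4 * y * y)); [apply Rmult_le_compat_l; lra|].
    assert (Rpower x b * y * y <= x ^ 2 * y) by (apply Rmult_le_compat_r; lra).
    nra.
Qed.

(* With [y = x^a], [y/(1+y)^2] is dominated by a decrement of [y/(1+y)] along
   the geometric sequence [q^n / eps], hence a bound uniform in [eps]. *)
Lemma power_kernel_sum (q b : R) : 0 < q < 1 -> 0 < b < 2 ->
  exists K, 0 < K /\ forall eps N, 0 < eps ->
    sum_n (fun n => Rpower q b ^ n / ((q ^ n) ^ 2 + eps ^ 2)) N <= K * Rpower eps (b - 2).
Proof.
  intros Hq Hb.
  (* The largest exponent that [power_kernel_le] admits; it is positive because [0 < b < 2]. *)
  set (a := Rmin b (2 - b)).
  assert (Ha1 : a <= b) by apply Rmin_l. assert (Ha2 : a <= 2 - b) by apply Rmin_r.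
  assert (Ha : 0 < a) by (apply Rmin_glb_lt; lra).
  set (k := Rpower q a).
  assert (Hk : 0 < k) by apply Rpower_gt_0.
  assert (Hk1 : k < 1).
  { unfold k; rewrite <- (Rpower_O q) by lra. unfold Rpower; apply exp_increasing.
    assert (ln q < 0) by (rewrite <- ln_1; apply ln_increasing; lra). nra. }
  exists (4 / (1 - k)); split; [apply Rdiv_lt_0_compat; lra|].
  intros eps N Heps.
  set (y := fun n => Rpower (q ^ n / eps) a).
  assert (Hy : forall n, 0 < y n) by (intros; apply Rpower_gt_0).
  assert (Hqn : forall n, 0 < q ^ n) by (intros; apply pow_lt; lra).
  assert (HyS : forall n, y (S n) = k * y n).
  { intros n; unfold y, k; rewrite Rpower_mult_distr; [f_equal; simpl; field; lra|lra|].
    apply Rdiv_lt_0_compat; auto. }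
  set (P := Rpower eps (b - 2)). assert (HP : 0 < P) by apply Rpower_gt_0.
  assert (H : sum_n (fun n => / P * (Rpower q b ^ n / ((q ^ n) ^ 2 + eps ^ 2))) N <= 4 / (1 - k)).
  { apply (sum_n_le_telescope _ (fun n => y n / (1 + y n))).
    - apply Rlt_le, Rdiv_lt_0_compat; lra.
    - intros n; specialize (Hy n); apply Rlt_le, Rdiv_lt_0_compat; lra.
    - specialize (Hy 0%nat); apply Rmult_le_reg_r with (1 + y 0%nat); [lra|].
      unfold Rdiv; rewrite Rmult_assoc, Rinv_l; lra.
    - intros n; set (x := q ^ n / eps).
      assert (Hx : 0 < x) by (apply Rdiv_lt_0_compat; auto).
      assert (E : / P * (Rpower q b ^ n / ((q ^ n) ^ 2 + eps ^ 2)) = Rpower x b / (1 + x ^ 2)).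
      { rewrite Rpower_pow_swap by lra.
        replace (q ^ n) with (x * eps) by (unfold x; field; lra).
        rewrite <- Rpower_mult_distr by lra.
        replace b with ((b - 2) + 2) at 2 by ring.
        rewrite Rpower_plus, Rpower_two by lra; fold P.
        field; repeat split; try lra; nra. }
      rewrite E; eapply Rle_trans; [apply (power_kernel_le x b a); lra|].
      fold (y n); rewrite HyS; specialize (Hy n); set (t := y n) in *.
      assert (Hkt : 0 < k * t) by (apply Rmult_lt_0_compat; auto).
      (* The decrement equals [(1 - k) t / ((1 + t) (1 + k t))], which explains the constant
         [4 / (1 - k)]; then [1 + k t <= 1 + t] is used. *)
      replace (4 / (1 - k) * (t / (1 + t) - k * t / (1 + k * t)))
        with (4 * (t / ((1 + t) * (1 + k * t)))) by (field; lra).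
      change (Rpower x a) with t; apply Rmult_le_compat_l; [lra|].
      unfold Rdiv; apply Rmult_le_compat_l; [lra|].
      apply Rinv_le_contravar; nra. }
  rewrite (sum_n_mult_l (K := R_Ring)) in H; unfold mult in H; simpl in H.
  apply Rmult_le_reg_l with (/ P); [now apply Rinv_0_lt_compat|].
  replace (/ P * (4 / (1 - k) * P)) with (4 / (1 - k)) by (field; lra); exact H.
Qed.

(** The modulus of a term of the series for [M]: with [q = r] and [b = |z| |zeta|] for the half
    [n >= 0], with [q = rho/r] and [b = rho^2 / (|z| |zeta|)] for the half [n < 0]. *)
Definition kernel_term (rho q eps b : R) (n : nat) : R :=
  b ^ n / ((q ^ n) ^ 2 + eps ^ 2 * (1 + (rho ^ n) ^ 2)).

Lemma sum_n_le (u v : nat -> R) N : (forall n, u n <= v n) -> sum_n u N <= sum_n v N.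
Proof.
  intros H; induction N as [|N IH]; [rewrite !sum_O; auto|].
  rewrite !sum_Sn; unfold plus; simpl; specialize (H (S N)); lra.
Qed.

Lemma sum_n_geom_le x N : 0 <= x < 1 -> sum_n (fun n => x ^ n) N <= / (1 - x).
Proof.
  intros Hx; rewrite sum_n_Reals, tech3 by lra.
  unfold Rdiv; rewrite <- (Rmult_1_l (/ (1 - x))) at 2.
  apply Rmult_le_compat_r; [apply Rlt_le, Rinv_0_lt_compat; lra|].
  assert (0 <= x ^ S N) by (apply pow_le; lra); lra.
Qed.

Section Kernel.

Variables rho q eps : R.
Hypothesis Heps : 0 < eps.

Lemma kernel_weight_ge n : (q ^ n) ^ 2 + eps ^ 2 <= (q ^ n) ^ 2 + eps ^ 2 * (1 + (rho ^ n) ^ 2).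
Proof. assert (A := pow2_ge_0 eps); assert (B := pow2_ge_0 (rho ^ n)); nra. Qed.

Lemma kernel_weight_gt_0 n : 0 < (q ^ n) ^ 2 + eps ^ 2 * (1 + (rho ^ n) ^ 2).
Proof.
  assert (A := pow_lt eps 2 Heps); assert (B := pow2_ge_0 (q ^ n)).
  assert (C := kernel_weight_ge n); lra.
Qed.

Lemma kernel_term_ge_0 b n : 0 <= b -> 0 <= kernel_term rho q eps b n.
Proof.
  intros Hb; apply Rmult_le_pos; [now apply pow_le|].
  apply Rlt_le, Rinv_0_lt_compat, kernel_weight_gt_0.
Qed.

Lemma kernel_term_le_drop b b' n : 0 <= b <= b' ->
  kernel_term rho q eps b n <= b' ^ n / ((q ^ n) ^ 2 + eps ^ 2).
Proof.
  intros Hb; unfold kernel_term, Rdiv.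
  apply Rmult_le_compat.
  - apply pow_le; lra.
  - apply Rlt_le, Rinv_0_lt_compat, kernel_weight_gt_0.
  - now apply pow_incr.
  - apply Rinv_le_contravar; [|apply kernel_weight_ge].
    assert (A := pow_lt eps 2 Heps); assert (B := pow2_ge_0 (q ^ n)); lra.
Qed.

End Kernel.

(* [a] is [|z|] or [rho/|z|] and [q] is [r] or [rho/r]: the half of the series
   on the side of [z] has [a = q^g], the other half has [a < q]. *)
Lemma kernel_sum_bounds (rho q a g : R) : 0 < rho < 1 -> 0 < q < 1 -> 0 < a < 1 -> 0 < g < 1 ->
  a = Rpower q g \/ a < q ->
  exists K, 0 < K /\
   (forall eps b N, 0 < eps -> 0 <= b <= a ->
      Rpower eps (2 - g) * sum_n (kernel_term rho q eps b) N <= K) /\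
   (forall eps b N, 0 < eps <= 1 -> 0 <= b <= a * q ->
      Rpower eps (2 - g) * sum_n (kernel_term rho q eps b) N <= K * eps) /\
   (forall eps b N, 0 < eps <= 1 -> 0 <= b <= a * a ->
      Rpower eps (2 - g) * sum_n (kernel_term rho q eps b) N <= K * Rpower eps g).
Proof.
  intros Hrho Hq Ha Hg [E|Haq].
  - assert (H : forall b, 0 < b < 2 -> exists K, 0 < K /\ forall eps b' N, 0 < eps ->
      0 <= b' <= Rpower q b ->
      Rpower eps (2 - g) * sum_n (kernel_term rho q eps b') N <= K * Rpower eps (b - g)).
    { intros b Hb; destruct (power_kernel_sum q b Hq Hb) as [K [HK B]].
      exists K; split; auto; intros eps b' N Heps Hb'.
      replace (b - g) with ((2 - g) + (b - 2)) by ring; rewrite Rpower_plus.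
      assert (P := Rpower_gt_0 eps (2 - g)).
      specialize (B eps N Heps).
      assert (L := sum_n_le _ _ N (fun n => kernel_term_le_drop rho q eps Heps b' _ n Hb')).
      nra. }
    (* The three uses are the supremum over the closed annulus ([b <= a = q^g]), the circle
       [|zeta| = r] ([b = a q = q^(g+1)]) and the value at [z] ([b = a a = q^(2g)]). They give the
       powers 0, 1 and [g] of [eps]; as [0 < g < 1], all three exponents of [q] lie strictly between
       0 and 2. *)
    destruct (H g) as [K1 [P1 H1]]; [lra|].
    destruct (H (g + 1)) as [K2 [P2 H2]]; [lra|].
    destruct (H (g + g)) as [K3 [P3 H3]]; [lra|].
    exists (K1 + K2 + K3); split; [lra|split; [|split]]; intros eps b N Heps Hb.
    + rewrite E in Hb; specialize (H1 eps b N Heps Hb).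
      rewrite Rminus_diag, Rpower_O in H1 by auto; lra.
    + assert (Hb' : 0 <= b <= Rpower q (g + 1))
        by now rewrite Rpower_plus, Rpower_1, <- E by lra.
      specialize (H2 eps b N (proj1 Heps) Hb').
      replace (g + 1 - g) with 1 in H2 by ring; rewrite Rpower_1 in H2 by lra; nra.
    + assert (Hb' : 0 <= b <= Rpower q (g + g)) by now rewrite Rpower_plus, <- E by lra.
      specialize (H3 eps b N (proj1 Heps) Hb').
      replace (g + g - g) with g in H3 by ring; assert (P := Rpower_gt_0 eps g); nra.
  (* On the side away from [z] the terms are dominated by the geometric series of ratio [a / q]. *)
  - assert (Hx : 0 <= a / q < 1).
    { split; [apply Rlt_le, Rdiv_lt_0_compat; lra|].
      apply Rmult_lt_reg_r with q; [lra|]; unfold Rdiv; rewrite Rmult_assoc, Rinv_l; lra. }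
    assert (Hqn : forall n, 0 < q ^ n <= 1).
    { intros n; split; [apply pow_lt; lra|]; rewrite <- (pow1 n); apply pow_incr; lra. }
    set (K := / (1 - a / q)).
    assert (HK : 0 < K) by (apply Rinv_0_lt_compat; lra).
    assert (F : forall eps b N, 0 < eps -> 0 <= b <= a * q ->
      sum_n (kernel_term rho q eps b) N <= K).
    { intros eps b N Heps Hb.
      eapply Rle_trans; [|apply (sum_n_geom_le (a / q) N Hx)].
      apply sum_n_le; intros n.
      eapply Rle_trans; [apply (kernel_term_le_drop rho q eps Heps b (a * q) n Hb)|].
      apply Rle_trans with ((a * q) ^ n / (q ^ n) ^ 2).
      - apply Rmult_le_compat_l; [apply pow_le; nra|].
        assert (A := pow2_ge_0 eps); specialize (Hqn n).
        apply Rinv_le_contravar; [apply pow_lt; lra|lra].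
      - unfold Rdiv; rewrite !Rpow_mult_distr, pow_inv.
        specialize (Hqn n); apply Req_le; field; lra. }
    exists K; split; [exact HK|split; [|split]]; intros eps b N Heps Hb.
    + rewrite <- (sum_n_mult_l (K := R_Ring)); unfold mult; simpl.
      eapply Rle_trans; [|apply (sum_n_geom_le (a / q) N Hx)].
      apply sum_n_le; intros n.
      assert (L := kernel_term_le_drop rho q eps Heps b a n Hb).
      assert (P := Rpower_gt_0 eps (2 - g)).
      eapply Rle_trans; [apply Rmult_le_compat_l; [lra|exact L]|].
      unfold Rdiv; rewrite Rpow_mult_distr, pow_inv.
      assert (An : 0 < a ^ n) by (apply pow_lt; lra).
      specialize (Hqn n); set (x := q ^ n) in *.
      rewrite <- Rmult_assoc, (Rmult_comm _ (a ^ n)), Rmult_assoc.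
      apply Rmult_le_compat_l; [lra|].
      assert (W : 0 < x ^ 2 + eps ^ 2) by nra.
      apply Rmult_le_reg_r with (x * (x ^ 2 + eps ^ 2)); [nra|].
      replace (Rpower eps (2 - g) * / (x ^ 2 + eps ^ 2) * (x * (x ^ 2 + eps ^ 2)))
        with (Rpower eps (2 - g) * x) by (field; lra).
      replace (/ x * (x * (x ^ 2 + eps ^ 2))) with (x ^ 2 + eps ^ 2) by (field; lra).
      (* The supremum of [M] is to be bounded for every [eps > 0], so the case [eps > 1] has to be
         treated; there [eps^(2-g) <= eps^2] and [x <= 1]. *)
      destruct (Rle_dec eps 1) as [L1|L1].
      * assert (Rpower eps (2 - g) <= eps).
        { rewrite <- (Rpower_1 eps Heps) at 2; apply Rpower_le_exponent_small; lra. }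
        assert (Q := pow2_ge_0 (x - eps)).
        apply Rle_trans with (eps * x); [apply Rmult_le_compat_r; lra|nra].
      * assert (Rpower eps (2 - g) <= eps ^ 2).
        { rewrite <- (Rpower_two eps Heps); apply Rpower_le_exponent_large; lra. }
        assert (Q := pow2_ge_0 x); assert (Q' := pow2_ge_0 eps).
        apply Rle_trans with (eps ^ 2 * x); [apply Rmult_le_compat_r; lra|nra].
    + specialize (F eps b N (proj1 Heps) Hb).
      assert (B : Rpower eps (2 - g) <= eps).
      { rewrite <- (Rpower_1 eps) at 2 by lra; apply Rpower_le_exponent_small; lra. }
      assert (P := Rpower_gt_0 eps (2 - g)); nra.
    + specialize (F eps b N (proj1 Heps) ltac:(nra)).
      assert (B : Rpower eps (2 - g) <= Rpower eps g) by (apply Rpower_le_exponent_small; lra).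
      assert (P := Rpower_gt_0 eps (2 - g)); nra.
Qed.

(** A single term suffices. With [q^(n+1)] between [q eps] and [eps], the numerator is at least
    [q^2 eps^(2g)] and the weight at most [3 eps^2]. The index is a successor so that it also occurs
    in the half [n < 0], which starts at 1. *)
Lemma kernel_term_lower (rho q g eps : R) :
  0 < rho < 1 -> 0 < q < 1 -> 0 < g < 1 -> 0 < eps <= 1 ->
  exists n, q ^ 2 / 3 * Rpower eps g <=
    Rpower eps (2 - g) * kernel_term rho q eps (Rpower q g * Rpower q g) (S n).
Proof.
  intros Hrho Hq Hg Heps.
  assert (Lq : ln q < 0) by (rewrite <- ln_1; apply ln_increasing; lra).
  assert (Le : ln eps <= 0) by (rewrite <- ln_1; apply ln_le; lra).
  destruct (nfloor_ex (ln eps / ln q)) as [n [N1 N2]].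
  { replace (ln eps / ln q) with (- ln eps * / - ln q) by (field; lra).
    apply Rmult_le_pos; [lra|]; apply Rlt_le, Rinv_0_lt_compat; lra. }
  exists n.
  set (x := q ^ S n).
  assert (Ex : ln x = INR (S n) * ln q) by (apply ln_pow; lra).
  assert (Hx : 0 < x) by (apply pow_lt; lra).
  assert (N1' : ln eps <= INR n * ln q).
  { replace (ln eps) with (ln eps / ln q * ln q) by (field; lra); nra. }
  assert (N2' : INR (S n) * ln q <= ln eps).
  { rewrite S_INR; replace (ln eps) with (ln eps / ln q * ln q) by (field; lra); nra. }
  assert (X1 : x <= eps).
  { rewrite <- Ex in N2'; apply Rnot_lt_le; intro L; apply ln_increasing in L; lra. }
  assert (X2 : q * eps <= x).
  { apply Rnot_lt_le; intro L; apply ln_increasing in L; auto.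
    rewrite ln_mult, Ex, S_INR in L by lra; lra. }
  unfold kernel_term; fold x.
  assert (R1 : rho ^ S n <= 1) by (rewrite <- (pow1 (S n)); apply pow_incr; lra).
  assert (R0 : 0 < rho ^ S n) by (apply pow_lt; lra).
  set (w := x ^ 2 + eps ^ 2 * (1 + (rho ^ S n) ^ 2)).
  assert (W : 0 < w <= 3 * eps ^ 2).
  { assert ((rho ^ S n) ^ 2 <= 1) by nra. assert (0 < x ^ 2) by (apply pow_lt; lra).
    assert (x ^ 2 <= eps ^ 2) by nra. assert (0 <= eps ^ 2) by nra.
    assert (0 <= (rho ^ S n) ^ 2) by nra.
    unfold w; split; nra. }
  rewrite <- Rpower_plus, Rpower_pow_swap by lra; fold x.
  assert (B : q ^ 2 * Rpower eps (g + g) <= Rpower x (g + g)).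
  { apply Rle_trans with (Rpower (q * eps) (g + g)); [|apply Rpower_le_base; nra].
    rewrite <- Rpower_mult_distr, <- Rpower_two by lra.
    apply Rmult_le_compat_r; [apply Rlt_le, Rpower_gt_0|].
    apply Rpower_le_exponent_small; lra. }
  apply Rmult_le_reg_r with w; [apply W|].
  replace (Rpower eps (2 - g) * (Rpower x (g + g) / w) * w)
    with (Rpower eps (2 - g) * Rpower x (g + g)) by (field; lra).
  apply Rle_trans with (q ^ 2 / 3 * Rpower eps g * (3 * eps ^ 2)).
  - apply Rmult_le_compat_l; [|apply W].
    assert (P := Rpower_gt_0 eps g); assert (0 < q ^ 2) by (apply pow_lt; lra).
    apply Rmult_le_pos; lra.
  - apply Rle_trans with (Rpower eps (2 - g) * (q ^ 2 * Rpower eps (g + g))).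
    + apply Req_le; rewrite <- (Rpower_two eps) by lra.
      replace (Rpower eps (2 - g) * (q ^ 2 * Rpower eps (g + g))) with
        (q ^ 2 * (Rpower eps (2 - g) * Rpower eps (g + g))) by ring.
      rewrite <- Rpower_plus; replace (2 - g + (g + g)) with (g + 2) by ring.
      rewrite Rpower_plus; field.
    + apply Rmult_le_compat_l; [apply Rlt_le, Rpower_gt_0|exact B].
Qed.

(** * Complex power series *)

Definition is_CS (a : nat -> C) (l : C) : Prop :=
  is_series (fun n => Re (a n)) (Re l) /\ is_series (fun n => Im (a n)) (Im l).

Lemma is_CS_unique a l : is_CS a l -> CSeries a = l.
Proof. intros [H1 H2]; apply injective_projections; simpl; now apply is_series_unique. Qed.

Lemma ex_series_Re a : ex_series (fun n => Cmod (a n)) -> ex_series (fun n => Re (a n)).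
Proof.
  apply (ex_series_le (V := R_CompleteNormedModule)); intros n; apply re_le_Cmod.
Qed.

Lemma ex_series_Im a : ex_series (fun n => Cmod (a n)) -> ex_series (fun n => Im (a n)).
Proof.
  apply (ex_series_le (V := R_CompleteNormedModule)); intros n; apply Im_le_Cmod.
Qed.

Lemma is_CS_CSeries a : ex_series (fun n => Cmod (a n)) -> is_CS a (CSeries a).
Proof.
  intros H; split; apply Series_correct; [now apply ex_series_Re|now apply ex_series_Im].
Qed.

Lemma is_CS_minus a b k l : is_CS a k -> is_CS b l -> is_CS (fun n => a n - b n)%C (k - l)%C.
Proof. intros [] []; split; now apply @is_series_minus. Qed.

Lemma is_CS_scal c a l : is_CS a l -> is_CS (fun n => c * a n)%C (c * l)%C.
Proof.
  intros [H1 H2]; split; simpl.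
  - apply (is_series_minus (V := R_NormedModule) (fun n => Re c * Re (a n)) (fun n => Im c * Im (a n)));
      now apply (is_series_scal (K := R_AbsRing) (V := R_NormedModule)).
  - apply (is_series_plus (V := R_NormedModule) (fun n => Re c * Im (a n)) (fun n => Im c * Re (a n)));
      now apply (is_series_scal (K := R_AbsRing) (V := R_NormedModule)).
Qed.

Lemma Cmod_CSeries_le a : ex_series (fun n => Cmod (a n)) ->
  Cmod (CSeries a) <= 2 * Series (fun n => Cmod (a n)).
Proof.
  intros H; eapply Rle_trans; [apply Cmod_le_add|]; simpl.
  assert (Q : forall b : nat -> R, (forall n, Rabs (b n) <= Cmod (a n)) ->
    Rabs (Series b) <= Series (fun n => Cmod (a n))).
  { intros b Hb.
    assert (Eb : ex_series (fun n => Rabs (b n))).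
    { apply (ex_series_le (V := R_CompleteNormedModule) _ (fun n => Cmod (a n))); auto.
      intros n; change (Rabs (Rabs (b n)) <= Cmod (a n)); now rewrite Rabs_Rabsolu. }
    eapply Rle_trans; [now apply Series_Rabs|].
    apply Series_le; auto; intros n; split; auto using Rabs_pos. }
  assert (Q1 := Q _ (fun n => re_le_Cmod (a n))).
  assert (Q2 := Q _ (fun n => Im_le_Cmod (a n))). lra.
Qed.

Lemma series_of_bounded_sums (a : nat -> R) K : (forall n, 0 <= a n) ->
  (forall N, sum_n a N <= K) -> ex_series a /\ Series a <= K.
Proof.
  intros Ha HK.
  destruct (ex_finite_lim_seq_incr (sum_n a) K) as [l Hl]; auto.
  - intros n; rewrite sum_Sn; unfold plus; simpl; specialize (Ha (S n)); lra.
  - split; [now exists l|].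
    rewrite (is_series_unique a l Hl).
    apply (is_lim_seq_le (sum_n a) (fun _ => K) l K); auto using is_lim_seq_const.
Qed.

Lemma Series_ge_term (a : nat -> R) n : (forall n, 0 <= a n) -> ex_series a -> a n <= Series a.
Proof.
  intros Ha He.
  assert (H : forall N, a n <= sum_n a (N + n)).
  { induction N as [|N IH].
    - simpl; destruct n as [|n]; [rewrite sum_O; lra|].
      rewrite sum_Sn; unfold plus; simpl.
      assert (0 <= sum_n a n); [|lra].
      clear -Ha; induction n as [|n IH]; [rewrite sum_O; auto|].
      rewrite sum_Sn; unfold plus; simpl; specialize (Ha (S n)); lra.
    - simpl (S N + n)%nat; rewrite sum_Sn; unfold plus; simpl; specialize (Ha (S (N + n))); lra. }
  assert (L := Series_correct a He).
  apply (is_lim_seq_le (fun _ => a n) (fun N => sum_n a (N + n)) (a n) (Series a)); auto.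
  - apply is_lim_seq_const.
  - now apply (is_lim_seq_incr_n (sum_n a)).
Qed.

(** With [x = t^(1/4)], the product [n x^n] is at most a partial geometric sum, hence at most
    [1 / (1 - x)]. Squaring it uses up [x^(2n)], and the remaining [x^(2n)] is summable. *)
Lemma ex_series_sqr_pow t : 0 < t < 1 -> ex_series (fun n => INR n ^ 2 * t ^ n).
Proof.
  intros Ht.
  set (x := sqrt (sqrt t)).
  assert (Hx : 0 < x) by (apply sqrt_lt_R0, sqrt_lt_R0; lra).
  assert (Hx4 : t = x ^ 4).
  { replace (x ^ 4) with ((x * x) * (x * x)) by ring.
    unfold x; rewrite sqrt_sqrt by apply sqrt_pos; now rewrite sqrt_sqrt by lra. }
  assert (Hx1 : x < 1).
  { apply Rnot_le_lt; intro L; assert (1 <= x ^ 4) by now apply pow_R1_Rle. lra. }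
  apply (ex_series_le (V := R_CompleteNormedModule) _ (fun n => (/ (1 - x)) ^ 2 * (x ^ 2) ^ n)).
  - intros n.
    change (Rabs (INR n ^ 2 * t ^ n) <= (/ (1 - x)) ^ 2 * (x ^ 2) ^ n).
    rewrite Rabs_right by (apply Rle_ge, Rmult_le_pos; [apply pow2_ge_0|apply pow_le; lra]).
    rewrite Hx4, <- !pow_mult, (Nat.mul_comm 4), (Nat.mul_comm 2), !pow_mult.
    assert (Hn : 0 < x ^ n) by now apply pow_lt.
    assert (B : INR n * x ^ n <= / (1 - x)).
    { eapply Rle_trans; [|apply (sum_n_geom_le x n); lra].
      clear Hx4; induction n as [|n IH].
      - rewrite sum_O; simpl; lra.
      - assert (Hn' : 0 < x ^ n) by now apply pow_lt.
        specialize (IH Hn'); rewrite sum_Sn, S_INR; unfold plus; simpl.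
        assert (0 <= INR n * x ^ n) by (apply Rmult_le_pos; [apply pos_INR|lra]).
        nra. }
    assert (0 <= INR n * x ^ n) by (apply Rmult_le_pos; [apply pos_INR|lra]).
    assert ((INR n * x ^ n) ^ 2 <= (/ (1 - x)) ^ 2) by (apply pow_incr; lra).
    replace (INR n ^ 2 * (x ^ n) ^ 4) with ((INR n * x ^ n) ^ 2 * (x ^ n) ^ 2) by ring.
    apply Rmult_le_compat_r; auto; apply pow2_ge_0.
  - apply (ex_series_scal (K := R_AbsRing) (V := R_NormedModule)).
    apply ex_series_geom; rewrite Rabs_right; nra.
Qed.

(* [n u^(n-1)], without the predecessor. *)
Fixpoint pow_deriv (u : C) (n : nat) : C :=
  match n with
  | O => 0
  | S n => u * pow_deriv u n + u ^ n
  end%C.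

Lemma Cmod_pow_deriv u t n : 0 < t -> Cmod u <= t -> Cmod (pow_deriv u n) * t <= INR n * t ^ n.
Proof.
  intros Ht Hu; induction n as [|n IH]; [simpl; rewrite Cmod_0; lra|].
  rewrite S_INR; simpl pow_deriv; simpl (t ^ _).
  assert (T := Cmod_triangle (u * pow_deriv u n) (u ^ n)).
  rewrite Cmod_mult, Cmod_pow in T.
  assert (P := pow_incr (Cmod u) t n (conj (Cmod_ge_0 u) Hu)).
  assert (P1 := Cmod_ge_0 (pow_deriv u n)). assert (P2 := Cmod_ge_0 u).
  assert (Cmod u * (Cmod (pow_deriv u n) * t) <= t * (INR n * t ^ n)).
  { apply Rmult_le_compat; auto; apply Rmult_le_pos; lra. }
  nra.
Qed.

(** The natural coefficient [n (n - 1) / 2] is relaxed to [n^2], for which the induction closes by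
    [n^2 + n <= (n + 1)^2]. The factor [t^2] on the left avoids the exponent [n - 2]. *)
Lemma Cmod_pow_taylor u w t n : 0 < t -> Cmod u <= t -> Cmod w <= t ->
  Cmod (w ^ n - u ^ n - (w - u) * pow_deriv u n) * t ^ 2 <= INR n ^ 2 * t ^ n * Cmod (w - u) ^ 2.
Proof.
  intros Ht Hu Hw.
  set (h := Cmod (w - u)). assert (Hh : 0 <= h) by apply Cmod_ge_0.
  induction n as [|n IH].
  - simpl (pow_deriv u 0); replace (w ^ 0 - u ^ 0 - (w - u) * 0)%C with (RtoC 0) by (simpl; ring).
    rewrite Cmod_0; simpl; lra.
  - simpl pow_deriv.
    replace (w ^ S n - u ^ S n - (w - u) * (u * pow_deriv u n + u ^ n))%C with
      (w * (w ^ n - u ^ n - (w - u) * pow_deriv u n) + (w - u) * (w - u) * pow_deriv u n)%C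
      by (simpl; ring).
    set (d := (w ^ n - u ^ n - (w - u) * pow_deriv u n)%C) in *.
    assert (T := Cmod_triangle (w * d) ((w - u) * (w - u) * pow_deriv u n)).
    rewrite !Cmod_mult in T; fold h in T.
    assert (Q := Cmod_pow_deriv u t n Ht Hu).
    assert (P1 := Cmod_ge_0 d). assert (P2 := Cmod_ge_0 w).
    assert (Pt : 0 < t ^ 2) by now apply pow_lt.
    assert (A1 : Cmod w * (Cmod d * t ^ 2) <= t * (INR n ^ 2 * t ^ n * h ^ 2)).
    { apply Rmult_le_compat; auto; apply Rmult_le_pos; lra. }
    assert (A2 : h * h * t * (Cmod (pow_deriv u n) * t) <= h * h * t * (INR n * t ^ n)).
    { apply Rmult_le_compat_l; auto; repeat apply Rmult_le_pos; lra. }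
    rewrite S_INR; simpl (t ^ S n).
    assert (Pn := pos_INR n). assert (Ptn : 0 < t ^ n) by now apply pow_lt.
    assert (0 <= h * h * t * t ^ n * (INR n + 1)) by (repeat apply Rmult_le_pos; lra).
    nra.
Qed.

(** Termwise differentiation: the second-order remainders of the monomials are summable, with total
    at most [K |w - u|^2]. *)
Lemma cdiff_power_series (k : nat -> R) (B : R) (u : C) :
  (forall n, Rabs (k n) <= B) -> Cmod u < 1 ->
  cdiff (fun w => CSeries (fun n => RtoC (k n) * w ^ n)%C) u.
Proof.
  intros HB Hu; assert (Pu := Cmod_ge_0 u).
  assert (PB : 0 <= B) by (eapply Rle_trans; [apply Rabs_pos|apply (HB 0%nat)]).
  (* A radius strictly between [|u|] and 1 leaves room for [w] around [u]. *)
  set (t := (1 + Cmod u) / 2).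
  assert (Ht : 0 < t < 1) by (unfold t; lra).
  assert (S0 := ex_series_sqr_pow t Ht).
  assert (Conv : forall w, Cmod w < 1 -> ex_series (fun n => Cmod (RtoC (k n) * w ^ n)%C)).
  { intros w Hw; apply (ex_series_le (V := R_CompleteNormedModule) _ (fun n => B * Cmod w ^ n)).
    - intros n; change (Rabs (Cmod (RtoC (k n) * w ^ n)) <= B * Cmod w ^ n).
      rewrite Rabs_right by apply Rle_ge, Cmod_ge_0.
      rewrite Cmod_mult, Cmod_R, Cmod_pow; apply Rmult_le_compat_r; auto.
      apply pow_le, Cmod_ge_0.
    - apply (ex_series_scal (K := R_AbsRing) (V := R_NormedModule)).
      apply ex_series_geom; rewrite Rabs_right; auto; apply Rle_ge, Cmod_ge_0. }
  assert (ConvD : ex_series (fun n => Cmod (RtoC (k n) * pow_deriv u n)%C)).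
  { apply (ex_series_le (V := R_CompleteNormedModule) _ (fun n => (B / t) * (INR n ^ 2 * t ^ n))).
    - intros n; change (Rabs (Cmod (RtoC (k n) * pow_deriv u n)) <= (B / t) * (INR n ^ 2 * t ^ n)).
      rewrite Rabs_right by apply Rle_ge, Cmod_ge_0.
      rewrite Cmod_mult, Cmod_R.
      assert (Q := Cmod_pow_deriv u t n (proj1 Ht) ltac:(unfold t; lra)).
      assert (Pt : 0 < t ^ n) by (apply pow_lt; lra).
      assert (Q2 : INR n * t ^ n <= INR n ^ 2 * t ^ n).
      { apply Rmult_le_compat_r; [lra|]; destruct n as [|n]; [simpl; lra|].
        assert (1 <= INR (S n)) by (rewrite S_INR; assert (P := pos_INR n); lra). nra. }
      apply Rmult_le_reg_r with t; [lra|].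
      replace (B / t * (INR n ^ 2 * t ^ n) * t) with (B * (INR n ^ 2 * t ^ n)) by (field; lra).
      rewrite Rmult_assoc; apply Rmult_le_compat; auto using Rabs_pos; [|lra].
      apply Rmult_le_pos; [apply Cmod_ge_0|lra].
    - now apply (ex_series_scal (K := R_AbsRing) (V := R_NormedModule)). }
  set (K := 2 * (B / t ^ 2 * Series (fun n => INR n ^ 2 * t ^ n))).
  assert (Pt2 : 0 < t ^ 2) by (apply pow_lt; lra).
  assert (HS : 0 <= Series (fun n => INR n ^ 2 * t ^ n)).
  { eapply Rle_trans; [|apply (Series_ge_term _ 0%nat); auto].
    - simpl; lra.
    - intros n; apply Rmult_le_pos; [apply pow2_ge_0|apply pow_le; lra]. }
  assert (HK : 0 <= K).
  { unfold K; repeat apply Rmult_le_pos; try lra. apply Rlt_le, Rinv_0_lt_compat, Pt2. }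
  apply cdiff_of_eps with (CSeries (fun n => RtoC (k n) * pow_deriv u n)%C); intros e He.
  exists (Rmin (t - Cmod u) (e / (K + 1))); split.
  { apply Rmin_glb_lt; [unfold t; lra|apply Rdiv_lt_0_compat; lra]. }
  intros w Hw.
  assert (W1 := Rlt_le_trans _ _ _ Hw (Rmin_l _ _)).
  assert (W2 := Rlt_le_trans _ _ _ Hw (Rmin_r _ _)).
  assert (Hwt : Cmod w <= t) by (assert (T := Cmod_triangle_sub w u); lra).
  set (h := Cmod (w - u)) in *. assert (Hh : 0 <= h) by apply Cmod_ge_0.
  set (d := fun n => (RtoC (k n) * (w ^ n - u ^ n - (w - u) * pow_deriv u n))%C).
  assert (Hd : forall n, Cmod (d n) <= B / t ^ 2 * h ^ 2 * (INR n ^ 2 * t ^ n)).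
  { intros n; unfold d; rewrite Cmod_mult, Cmod_R.
    assert (Q := Cmod_pow_taylor u w t n (proj1 Ht) ltac:(unfold t; lra) Hwt); fold h in Q.
    apply Rmult_le_reg_r with (t ^ 2); auto.
    replace (B / t ^ 2 * h ^ 2 * (INR n ^ 2 * t ^ n) * t ^ 2) with
      (B * (INR n ^ 2 * t ^ n * h ^ 2)) by (field; lra).
    rewrite Rmult_assoc; apply Rmult_le_compat; auto using Rabs_pos.
    apply Rmult_le_pos; [apply Cmod_ge_0|lra]. }
  assert (Ed : ex_series (fun n => Cmod (d n))).
  { eapply (ex_series_le (V := R_CompleteNormedModule)).
    - intros n; eapply Rle_trans; [|apply (Hd n)].
      change (Rabs (Cmod (d n)) <= Cmod (d n)); rewrite Rabs_right; [lra|].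
      apply Rle_ge, Cmod_ge_0.
    - now apply (ex_series_scal (K := R_AbsRing) (V := R_NormedModule)). }
  assert (E : CSeries d = (CSeries (fun n => RtoC (k n) * w ^ n) - CSeries (fun n => RtoC (k n) * u ^ n)
     - (w - u) * CSeries (fun n => RtoC (k n) * pow_deriv u n))%C).
  { apply is_CS_unique.
    assert (I := is_CS_minus _ _ _ _
      (is_CS_minus _ _ _ _ (is_CS_CSeries _ (Conv w ltac:(lra))) (is_CS_CSeries _ (Conv u Hu)))
      (is_CS_scal (w - u)%C _ _ (is_CS_CSeries _ ConvD))).
    destruct I as [I1 I2]; split; (eapply is_series_ext; [|eassumption]);
      intros n; cbv beta; f_equal; unfold d; ring. }
  rewrite <- E.
  eapply Rle_trans; [now apply Cmod_CSeries_le|].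
  assert (L : Series (fun n => Cmod (d n)) <= B / t ^ 2 * h ^ 2 * Series (fun n => INR n ^ 2 * t ^ n)).
  { rewrite <- Series_scal_l; apply Series_le; [intros n; split; [apply Cmod_ge_0|apply Hd]|].
    now apply (ex_series_scal (K := R_AbsRing) (V := R_NormedModule)). }
  apply Rle_trans with (K * h * h); [unfold K; nra|].
  apply Rmult_le_compat_r; auto.
  assert (Hke : h * (K + 1) < e).
  { apply Rmult_lt_reg_r with (/ (K + 1)); [apply Rinv_0_lt_compat; lra|].
    rewrite Rmult_assoc, Rinv_r by lra; lra. }
  nra.
Qed.

(** * The extremal function *)

Lemma Cinv_0 : (/ 0)%C = 0.
Proof. apply injective_projections; simpl; unfold Rdiv; ring. Qed.

(** At 0 this rests on the value 0 of the inverse there. It makes [Mterm_neg] valid for every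
    [zeta], as [cdiff_ext] in [cdiff_M] demands. *)
Lemma Cpow_inv_total (x : C) n : (/ x ^ n)%C = ((/ x) ^ n)%C.
Proof.
  destruct (Ceq_dec x 0) as [->|N]; [|now rewrite Cpow_inv].
  destruct n as [|n].
  - simpl; field; intro E; injection E; lra.
  - rewrite Cinv_0, !Cpow_S, !Cmult_0_l; apply Cinv_0.
Qed.

Lemma sumZ_zlist N u :
  sumZ (zlist (S N)) u =
  sum_n (fun n => u (Z.of_nat n)) N + sum_n (fun n => u (- Z.of_nat (S n))%Z) N.
Proof.
  induction N as [|N IH].
  - rewrite !sum_O; simpl; ring.
  - rewrite sumZ_zlist_S, IH, !sum_Sn; unfold plus; simpl; ring.
Qed.

Lemma sum_n_shift_le (u : nat -> R) N : 0 <= u 0%nat ->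
  sum_n (fun n => u (S n)) N <= sum_n u (S N).
Proof.
  intros H0.
  assert (E : sum_n u (S N) = u 0%nat + sum_n (fun n => u (S n)) N); [|lra].
  induction N as [|N IH].
  - rewrite sum_Sn, !sum_O; reflexivity.
  - rewrite sum_Sn, IH, sum_Sn; unfold plus; simpl; ring.
Qed.

Section Extremal.

Variables (rho r : R) (z : C).
Hypothesis Hrho : 0 < rho < 1.
Hypothesis Hr : rho < r < 1.
Hypothesis Hz : annulus rho z.

Let a := Cmod z.

Lemma Cmod_z_bounds : rho < a < 1.
Proof. exact Hz. Qed.

Lemma z_neq_0 : z <> 0.
Proof. apply Cmod_gt_0; assert (A := Cmod_z_bounds); unfold a in A; lra. Qed.

Lemma dual_bounds s : rho < s < 1 -> 0 < rho / s < 1.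
Proof.
  intros Hs; split; [apply Rdiv_lt_0_compat; lra|].
  apply Rmult_lt_reg_r with s; [lra|]; unfold Rdiv; rewrite Rmult_assoc, Rinv_l; lra.
Qed.

Definition weight (q eps : R) (n : nat) : R := (q ^ n) ^ 2 + eps ^ 2 * (1 + (rho ^ n) ^ 2).

Lemma weight_gt_0 q eps n : 0 < eps -> 0 < weight q eps n.
Proof. intros; now apply kernel_weight_gt_0. Qed.

Lemma inv_weight_le q eps n : 0 < eps -> Rabs (/ weight q eps n) <= / eps ^ 2.
Proof.
  intros He; assert (W := weight_gt_0 q eps n He).
  rewrite Rabs_right by (apply Rle_ge, Rlt_le, Rinv_0_lt_compat, W).
  apply Rinv_le_contravar; [now apply pow_lt|].
  assert (Q := kernel_weight_ge rho q eps n); unfold weight.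
  assert (P := pow2_ge_0 (q ^ n)); lra.
Qed.

Lemma Z_weight_pos eps n :
  powerRZ r (2 * Z.of_nat n) + eps ^ 2 * (1 + powerRZ rho (2 * Z.of_nat n)) = weight r eps n.
Proof. rewrite !powerRZ_double, <- !pow_powerRZ; reflexivity. Qed.

(** Multiplication by [rho^(2n)] exchanges the contributions of the two boundary circles and turns
    [r^(-2n)] into [(rho/r)^(2n)]. *)
Lemma Z_weight_neg eps n :
  powerRZ r (2 * - Z.of_nat n) + eps ^ 2 * (1 + powerRZ rho (2 * - Z.of_nat n)) =
  weight (rho / r) eps n / (rho ^ n) ^ 2.
Proof.
  rewrite !powerRZ_double, !powerRZ_neg', <- !pow_powerRZ; unfold weight.
  replace ((rho / r) ^ n) with (rho ^ n / r ^ n)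
    by (unfold Rdiv; now rewrite Rpow_mult_distr, pow_inv).
  assert (0 < r ^ n) by (apply pow_lt; lra). assert (0 < rho ^ n) by (apply pow_lt; lra).
  field; lra.
Qed.

(* The terms [n < 0] of [M] form a power series in this variable. *)
Definition inner_variable (zeta : C) : C := (RtoC (rho * rho) * / (Cconj z * zeta))%C.

Lemma Mterm_pos eps (zeta : C) n : 0 < eps ->
  Mterm rho r z eps zeta (Z.of_nat n) =
  (RtoC (/ weight r eps n) * (Cconj z * zeta) ^ n)%C.
Proof.
  intros He; assert (W := weight_gt_0 r eps n He).
  unfold Mterm; rewrite CpowZ_of_nat, Z_weight_pos, RtoC_inv by lra.
  unfold Cdiv; ring.
Qed.

Lemma Mterm_neg eps (zeta : C) n : 0 < eps ->
  Mterm rho r z eps zeta (- Z.of_nat (S n)) =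
  (RtoC (/ weight (rho / r) eps (S n)) * inner_variable zeta ^ S n)%C.
Proof.
  intros He; assert (W := weight_gt_0 (rho / r) eps (S n) He).
  unfold Mterm, inner_variable; rewrite CpowZ_opp_S, Z_weight_neg.
  assert (P : 0 < (rho ^ S n) ^ 2) by (apply pow_lt, pow_lt; lra).
  rewrite Cpow_inv_total, (Cpow_mult_l (RtoC (rho * rho))), <- RtoC_pow, Rpow_mult_distr.
  unfold Cdiv; rewrite <- RtoC_inv
    by (apply Rgt_not_eq, Rdiv_lt_0_compat; auto).
  replace (/ (weight (rho / r) eps (S n) / (rho ^ S n) ^ 2)) with
    (/ weight (rho / r) eps (S n) * (rho ^ S n * rho ^ S n)) by (field; split; [nra|lra]).
  rewrite RtoC_mult; ring.
Qed.

Lemma Cmod_inner_variable (zeta : C) : zeta <> 0 ->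
  Cmod (inner_variable zeta) = rho / a * (rho / Cmod zeta).
Proof.
  intros Hzeta; unfold inner_variable.
  assert (Hc : Cconj z <> 0).
  { apply Cmod_gt_0; rewrite Cmod_conj; assert (A := Cmod_z_bounds); unfold a in A; lra. }
  assert (Q := proj1 (Cmod_gt_0 _) Hzeta). assert (A := Cmod_z_bounds).
  rewrite Cmod_mult, Cmod_R, Cmod_inv, Cmod_mult, Cmod_conj by now apply Cmult_neq_0.
  fold a; rewrite Rabs_right by nra; field; lra.
Qed.

Lemma Cmod_Mterm_pos eps (zeta : C) n : 0 < eps ->
  Cmod (Mterm rho r z eps zeta (Z.of_nat n)) = kernel_term rho r eps (a * Cmod zeta) n.
Proof.
  intros He; rewrite Mterm_pos, Cmod_mult, Cmod_R, Cmod_pow, Cmod_mult, Cmod_conj by auto.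
  assert (W := weight_gt_0 r eps n He).
  rewrite Rabs_right by (apply Rle_ge, Rlt_le, Rinv_0_lt_compat, W).
  unfold kernel_term, Rdiv; apply Rmult_comm.
Qed.

Lemma Cmod_Mterm_neg eps (zeta : C) n : 0 < eps -> zeta <> 0 ->
  Cmod (Mterm rho r z eps zeta (- Z.of_nat (S n))) =
  kernel_term rho (rho / r) eps (rho / a * (rho / Cmod zeta)) (S n).
Proof.
  intros He Hzeta; rewrite Mterm_neg, Cmod_mult, Cmod_R, Cmod_pow, Cmod_inner_variable by auto.
  assert (W := weight_gt_0 (rho / r) eps (S n) He).
  rewrite Rabs_right by (apply Rle_ge, Rlt_le, Rinv_0_lt_compat, W).
  unfold kernel_term, Rdiv; apply Rmult_comm.
Qed.

Lemma Mterm_summable eps (zeta : C) K1 K2 : 0 < eps -> zeta <> 0 ->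
  (forall N, sum_n (kernel_term rho r eps (a * Cmod zeta)) N <= K1) ->
  (forall N, sum_n (kernel_term rho (rho / r) eps (rho / a * (rho / Cmod zeta))) N <= K2) ->
  (ex_series (fun n => Cmod (Mterm rho r z eps zeta (Z.of_nat n))) /\
   Series (fun n => Cmod (Mterm rho r z eps zeta (Z.of_nat n))) <= K1) /\
  (ex_series (fun n => Cmod (Mterm rho r z eps zeta (- Z.of_nat (S n)))) /\
   Series (fun n => Cmod (Mterm rho r z eps zeta (- Z.of_nat (S n)))) <= K2).
Proof.
  intros He Hzeta H1 H2; assert (A := Cmod_z_bounds).
  assert (Q := proj1 (Cmod_gt_0 _) Hzeta).
  split; apply series_of_bounded_sums; try (intros; apply Cmod_ge_0); intros N.
  - rewrite (sum_n_ext _ (kernel_term rho r eps (a * Cmod zeta))); auto.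
    intros n; now apply Cmod_Mterm_pos.
  - rewrite (sum_n_ext _ (fun n => kernel_term rho (rho / r) eps (rho / a * (rho / Cmod zeta)) (S n)))
      by (intros n; now apply Cmod_Mterm_neg).
    (* The half [n < 0] starts at index 1; adding the nonnegative term of index 0 gives the sum that
       [H2] bounds. *)
    eapply Rle_trans; [apply sum_n_shift_le|apply H2].
    apply kernel_term_ge_0; auto.
    apply Rmult_le_pos; apply Rlt_le, Rdiv_lt_0_compat; lra.
Qed.

Lemma Cmod_M_le eps (zeta : C) K1 K2 : 0 < eps -> zeta <> 0 ->
  (forall N, Rpower eps (2 - gamma rho r z) * sum_n (kernel_term rho r eps (a * Cmod zeta)) N <= K1) ->
  (forall N, Rpower eps (2 - gamma rho r z) *
     sum_n (kernel_term rho (rho / r) eps (rho / a * (rho / Cmod zeta))) N <= K2) ->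
  Cmod (M rho r z eps zeta) <= 2 * (K1 + K2).
Proof.
  intros He Hzeta H1 H2.
  set (e := Rpower eps (2 - gamma rho r z)) in *.
  assert (Pe : 0 < e) by apply Rpower_gt_0.
  assert (D : forall S K, e * S <= K -> S <= K / e).
  { intros S K H; apply Rmult_le_reg_l with e; auto.
    replace (e * (K / e)) with K by (field; lra); auto. }
  destruct (Mterm_summable eps zeta (K1 / e) (K2 / e)) as [[E1 B1] [E2 B2]]; auto.
  unfold M; fold e; rewrite Cmod_mult, Cmod_R, Rabs_right by lra.
  unfold ZSeries.
  assert (T := Cmod_triangle (CSeries (fun n : nat => Mterm rho r z eps zeta (Z.of_nat n)))
    (CSeries (fun n : nat => Mterm rho r z eps zeta (- Z.of_nat (S n))))).
  assert (C1 := Cmod_CSeries_le _ E1). assert (C2 := Cmod_CSeries_le _ E2).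
  apply Rle_trans with (e * (2 * (K1 / e + K2 / e))); [|apply Req_le; field; lra].
  apply Rmult_le_compat_l; lra.
Qed.

(** Both halves are power series with coefficients at most [1 / eps^2], so it is enough that their
    variables have modulus below 1, that is [rho^2 / |z| < |zeta| < 1 / |z|]. *)
Lemma cdiff_M eps (zeta : C) : 0 < eps -> zeta <> 0 ->
  a * Cmod zeta < 1 -> rho / a * (rho / Cmod zeta) < 1 -> cdiff (M rho r z eps) zeta.
Proof.
  intros He Hzeta H1 H2.
  assert (Hc : Cconj z <> 0).
  { apply Cmod_gt_0; rewrite Cmod_conj; assert (A := Cmod_z_bounds); unfold a in A; lra. }
  set (k1 := fun n => / weight r eps n).
  (* A zero coefficient at index 0 makes the half [n < 0] an ordinary power series in
     [inner_variable]. *)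
  set (k2 := fun n => match n with O => 0 | S _ => / weight (rho / r) eps n end).
  apply cdiff_ext with (fun w => RtoC (Rpower eps (2 - gamma rho r z)) *
    (CSeries (fun n => RtoC (k1 n) * (Cconj z * w) ^ n) +
     CSeries (fun n => RtoC (k2 n) * inner_variable w ^ n)))%C.
  - intros w; unfold M, ZSeries; f_equal; f_equal.
    + unfold CSeries; f_equal; apply Series_ext; intros n; now rewrite Mterm_pos.
    + unfold CSeries; f_equal; rewrite Series_incr_1_aux by (simpl; ring);
        apply Series_ext; intros n; now rewrite Mterm_neg.
  - apply cdiff_mult; [apply cdiff_const|]; apply cdiff_plus.
    + apply (cdiff_comp (fun u => CSeries (fun n => RtoC (k1 n) * u ^ n)%C) (fun w => Cconj z * w)%C).
      * apply cdiff_mult; [apply cdiff_const|apply cdiff_id].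
      * apply cdiff_power_series with (/ eps ^ 2).
        -- intros n; now apply inv_weight_le.
        -- now rewrite Cmod_mult, Cmod_conj.
    + apply (cdiff_comp (fun u => CSeries (fun n => RtoC (k2 n) * u ^ n)%C) inner_variable).
      * apply cdiff_mult; [apply cdiff_const|].
        apply (cdiff_comp Cinv (fun w => Cconj z * w)%C).
        -- apply cdiff_mult; [apply cdiff_const|apply cdiff_id].
        -- apply cdiff_inv; now apply Cmult_neq_0.
      * apply cdiff_power_series with (/ eps ^ 2).
        -- intros [|n]; [|now apply inv_weight_le].
           simpl; rewrite Rabs_R0; apply Rlt_le, Rinv_0_lt_compat; nra.
        -- now rewrite Cmod_inner_variable.
Qed.

Lemma Mterm_at_z_pos eps n : 0 < eps ->
  Mterm rho r z eps z (Z.of_nat n) = RtoC (kernel_term rho r eps (a * a) n).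
Proof.
  intros He; rewrite Mterm_pos by auto.
  rewrite (Cmult_comm (Cconj z)), <- Cmod2_conj, <- RtoC_pow, <- RtoC_mult.
  fold a; f_equal; unfold kernel_term, Rdiv; rewrite Rmult_comm; f_equal; f_equal; ring.
Qed.

Lemma Mterm_at_z_neg eps n : 0 < eps ->
  Mterm rho r z eps z (- Z.of_nat (S n)) =
  RtoC (kernel_term rho (rho / r) eps (rho / a * (rho / a)) (S n)).
Proof.
  intros He; rewrite Mterm_neg by auto; unfold inner_variable.
  assert (A := Cmod_z_bounds).
  rewrite (Cmult_comm (Cconj z)), <- Cmod2_conj, <- RtoC_inv by (fold a; nra).
  rewrite <- RtoC_mult, <- RtoC_pow, <- RtoC_mult.
  fold a; f_equal; unfold kernel_term, Rdiv; rewrite Rmult_comm; f_equal; f_equal; field; lra.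
Qed.

(** At [zeta = z] every term of the series is real and nonnegative, so each one is a lower bound for
    the sum. *)
Lemma M_at_z_ge_term eps K1 K2 : 0 < eps ->
  (forall N, sum_n (kernel_term rho r eps (a * a)) N <= K1) ->
  (forall N, sum_n (kernel_term rho (rho / r) eps (rho / a * (rho / a))) N <= K2) ->
  forall n,
  Rpower eps (2 - gamma rho r z) * kernel_term rho r eps (a * a) n <= Cmod (M rho r z eps z) /\
  Rpower eps (2 - gamma rho r z) * kernel_term rho (rho / r) eps (rho / a * (rho / a)) (S n)
    <= Cmod (M rho r z eps z).
Proof.
  intros He H1 H2 n; assert (A := Cmod_z_bounds).
  destruct (Mterm_summable eps z K1 K2) as [[E1 _] [E2 _]]; auto using z_neq_0.
  set (e := Rpower eps (2 - gamma rho r z)) in *.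
  assert (Pe : 0 < e) by apply Rpower_gt_0.
  set (u := kernel_term rho r eps (a * a)).
  set (v := fun n => kernel_term rho (rho / r) eps (rho / a * (rho / a)) (S n)).
  assert (Pu : forall n, 0 <= u n) by (intros; apply kernel_term_ge_0; auto; nra).
  assert (Pv : forall n, 0 <= v n).
  { intros; apply kernel_term_ge_0; auto; apply Rmult_le_pos; apply Rlt_le, Rdiv_lt_0_compat; lra. }
  assert (Eu : ex_series u).
  { eapply ex_series_ext; [|exact E1]; intros k; cbv beta.
    rewrite Mterm_at_z_pos, Cmod_R, Rabs_right; auto; apply Rle_ge, Pu. }
  assert (Ev : ex_series v).
  { eapply ex_series_ext; [|exact E2]; intros k; cbv beta.
    rewrite Mterm_at_z_neg, Cmod_R, Rabs_right; auto; apply Rle_ge, Pv. }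
  assert (EM : Re (M rho r z eps z) = e * (Series u + Series v)).
  { unfold M; fold e; rewrite re_scal_l; f_equal.
    change (Series (fun k => Re (Mterm rho r z eps z (Z.of_nat k))) +
      Series (fun k => Re (Mterm rho r z eps z (- Z.of_nat (S k)))) = Series u + Series v).
    f_equal; apply Series_ext; intros k;
      [rewrite Mterm_at_z_pos by auto|rewrite (Mterm_at_z_neg eps k) by auto]; reflexivity. }
  assert (L := re_le_Cmod (M rho r z eps z)). rewrite EM in L.
  assert (Lu := Series_ge_term u n Pu Eu). assert (Lv := Series_ge_term v n Pv Ev).
  assert (Lu0 := Series_ge_term u 0 Pu Eu). assert (Lv0 := Series_ge_term v 0 Pv Ev).
  assert (Pu0 := Pu 0%nat). assert (Pv0 := Pv 0%nat).
  assert (0 <= e * (Series u + Series v)) by (apply Rmult_le_pos; lra).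
  rewrite Rabs_right in L by lra.
  fold (v n); fold (u n).
  split; (eapply Rle_trans; [|exact L]); apply Rmult_le_compat_l; lra.
Qed.

(** Supplies the alternative of [kernel_sum_bounds] for both halves at once: a power relation on the
    side of [z], a strict inequality on the other. *)
Lemma gamma_cases : a <> r ->
  0 < gamma rho r z < 1 /\
  ((a = Rpower r (gamma rho r z) /\ rho / a < rho / r) \/
   (a < r /\ rho / a = Rpower (rho / r) (gamma rho r z))).
Proof.
  intros N; assert (A := Cmod_z_bounds); unfold gamma; fold a.
  assert (Lr : ln r < 0) by (rewrite <- ln_1; apply ln_increasing; lra).
  destruct (Rlt_dec r a) as [L|L].
  - assert (La : ln r < ln a) by (apply ln_increasing; lra).
    assert (La0 : ln a < 0) by (rewrite <- ln_1; apply ln_increasing; lra).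
    split; [|left; split].
    + replace (ln a / ln r) with (- ln a * / - ln r) by (field; lra).
      split; [apply Rmult_lt_0_compat; [lra|apply Rinv_0_lt_compat; lra]|].
      apply Rmult_lt_reg_r with (- ln r); [lra|]; rewrite Rmult_assoc, Rinv_l; lra.
    + unfold Rpower; replace (ln a / ln r * ln r) with (ln a) by (field; lra).
      now rewrite exp_ln by lra.
    + apply Rmult_lt_compat_l; [lra|]; apply Rinv_lt_contravar; [nra|auto].
  - assert (L' : a < r) by lra.
    rewrite !ln_div by lra.
    assert (L1 : ln rho < ln a) by (apply ln_increasing; lra).
    assert (L2 : ln a < ln r) by (apply ln_increasing; lra).
    split; [|right; split; auto].
    + split; [apply Rdiv_lt_0_compat; lra|].
      apply Rmult_lt_reg_r with (ln r - ln rho); [lra|].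
      unfold Rdiv; rewrite Rmult_assoc, Rinv_l; lra.
    + unfold Rpower; rewrite ln_div by lra.
      replace ((ln a - ln rho) / (ln r - ln rho) * (ln rho - ln r)) with (ln rho - ln a)
        by (field; lra).
      rewrite <- ln_div, exp_ln; auto; [apply Rdiv_lt_0_compat|..]; lra.
Qed.

End Extremal.

(** * Norm estimates and the pointwise bound *)

Lemma L2norm_le_sup s f c : 0 < s < 1 -> 0 <= c ->
  (forall t, ccont f (circle_point s t)) ->
  (forall t, Cmod (f (circle_point s t)) <= c) -> L2norm s f <= 3 * c.
Proof.
  intros Hs Hc Hf HB; unfold L2norm; assert (PP := PI_RGT_0); assert (P4 := PI_4).
  (* The constant 3 works because [2 PI s <= 8 < 9]. *)
  rewrite <- (sqrt_square (3 * c)) by lra; apply sqrt_le_1_alt.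
  eapply Rle_trans.
  - apply (RInt_le _ (fun _ => c ^ 2)); [lra| |apply ex_RInt_const|].
    + assert (Q := ex_RInt_Cmod_sqr (fun t => f (circle_point s t)) 0 (2 * PI)
        (fun t => pcont_circle_point f s t (Hf t))).
      apply (ex_RInt_scal _ _ _ s) in Q; revert Q; apply ex_RInt_ext.
      intros t _; apply Rmult_comm.
    + intros t _; cbv beta; assert (P := Cmod_ge_0 (f (circle_point s t))).
      assert (Cmod (f (circle_point s t)) ^ 2 <= c ^ 2) by (apply pow_incr; split; auto).
      assert (0 <= Cmod (f (circle_point s t)) ^ 2) by apply pow2_ge_0. nra.
  - rewrite RInt_const; unfold scal; simpl; unfold mult; simpl.
    assert (0 <= c * c) by nra. nra.
Qed.

Lemma H2norm_ge rho f s : rho < s < 1 -> Rbar_le (L2norm s f) (H2norm rho f).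
Proof. intros Hs; apply Lub_Rbar_correct; now exists s. Qed.

Lemma open_Cmod_interval (x y : R) : open (fun zeta : C => x < Cmod zeta < y).
Proof.
  intros w [H1 H2].
  assert (Hd : 0 < Rmin (Cmod w - x) (y - Cmod w)) by (apply Rmin_glb_lt; lra).
  apply locally_C, locally_C_eps; exists (Rmin (Cmod w - x) (y - Cmod w)); split; auto.
  intros v Hv.
  assert (V1 := Rlt_le_trans _ _ _ Hv (Rmin_l _ _)).
  assert (V2 := Rlt_le_trans _ _ _ Hv (Rmin_r _ _)).
  assert (T1 := Cmod_triangle_sub v w).
  assert (T2 := Cmod_triangle_sub w v); rewrite Cmod_sub_comm in T2; lra.
Qed.

(** Replaces Cauchy-Schwarz by a termwise inequality with a free parameter [l], which can be summed
    over a list directly. *)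
Lemma young_weighted x y w l : 0 < w -> 0 < l ->
  x * y <= / 2 * (l * (x ^ 2 * w) + / l * (y ^ 2 / w)).
Proof.
  intros Hw Hl; assert (Q := pow2_ge_0 (l * w * x - y)).
  assert (P : 0 < l * w) by now apply Rmult_lt_0_compat.
  apply Rmult_le_reg_r with (2 * (l * w)); [lra|].
  replace (/ 2 * (l * (x ^ 2 * w) + / l * (y ^ 2 / w)) * (2 * (l * w)))
    with ((l * w * x) ^ 2 + y ^ 2) by (field; lra).
  lra.
Qed.

Lemma Hardy_pointwise_bound rho r z f eps K g :
  0 < rho < 1 -> rho < r < 1 -> annulus rho z ->
  (forall zeta, annulus rho zeta -> cdiff f zeta) ->
  (forall s, rho < s < 1 -> L2norm s f <= 1) -> L2norm r f <= eps -> 0 < eps ->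
  (forall N, Rpower eps (2 - g) * sumZ (zlist N) (fun n => powerRZ (Cmod z) n ^ 2 /
     (powerRZ r (2 * n) + eps ^ 2 * (1 + powerRZ rho (2 * n)))) <= K * Rpower eps g) ->
  Cmod (f z) <= (6 * PI / rho + K) * Rpower eps g.
Proof.
  intros Hrho Hr Hz Hf H1 Heps Pe HK; assert (PP := PI_RGT_0). assert (P2 := PI2_1).
  set (w := fun n => powerRZ r (2 * n) + eps ^ 2 * (1 + powerRZ rho (2 * n))) in *.
  assert (Hw : forall n, 0 < w n).
  { intros n; unfold w; assert (Q1 := powerRZ_lt r (2 * n) ltac:(lra)).
    assert (Q2 := powerRZ_lt rho (2 * n) ltac:(lra)). assert (Q3 := pow2_ge_0 eps). nra. }
  (* The two sums have sizes [eps^2] and [eps^(2g-2)]; this [l] balances them, so that both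
     contributions are of size [eps^g]. *)
  set (l := Rpower eps (g - 2)). assert (Hl : 0 < l) by apply Rpower_gt_0.
  assert (El : / l = Rpower eps (2 - g)).
  { unfold l; rewrite <- Rpower_Ropp; f_equal; ring. }
  assert (El2 : l * eps ^ 2 = Rpower eps g).
  { unfold l; rewrite <- Rpower_two, <- Rpower_plus by auto; f_equal; ring. }
  assert (B : 2 * PI * Cmod (f z) <= / 2 * ((6 * PI / rho + K) * Rpower eps g)).
  { apply le_epsilon; intros eta Heta.
    destruct (laurent_partial_sum f rho z eta Hrho Hz Hf Heta) as [N L].
    eapply Rle_trans; [exact L|]; rewrite Rplus_comm; apply Rplus_le_compat_r.
    eapply Rle_trans; [apply sumZ_le; intros n; apply (young_weighted _ _ (w n) l); auto|].
    rewrite sumZ_scal, sumZ_plus, !sumZ_scal.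
    apply Rmult_le_compat_l; [lra|].
    rewrite Rmult_plus_distr_r; apply Rplus_le_compat.
    - rewrite <- El2.
      replace (6 * PI / rho * (l * eps ^ 2)) with (l * (6 * PI / rho * eps ^ 2)) by ring.
      apply Rmult_le_compat_l; [lra|].
      rewrite (sumZ_ext _ _ (fun n => Cmod (laurent f r n) ^ 2 * w n)).
      + apply sumZ_laurent_weighted_le; auto using NoDup_zlist.
      + intros n _; now rewrite (laurent_radius f rho (Cmod z) r) by (auto; lra).
    - rewrite El; apply HK. }
  assert (P := Cmod_ge_0 (f z)). nra.
Qed.

Theorem theorem2p1 (rho r : R) (z : C)
  (hrho : 0 < rho < 1) (hr : rho < r < 1)
  (hz : annulus rho z) (hzr : ~ circle r z) :
  (exists K : R, 0 < K /\
     forall (eps : R) (f : C -> C), 0 < eps ->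
       H2 rho f -> Rbar_le (H2norm rho f) 1 -> L2norm r f <= eps ->
       Cmod (f z) <= K * Rpower eps (gamma rho r z))
  /\
  (forall (eps : R) (zeta : C), 0 < eps -> annulus rho zeta ->
     ex_Zseries (Mterm rho r z eps zeta))
  /\
  (exists c1 c2 c3 c4 eps0 : R,
     0 < c1 /\ 0 < c2 /\ 0 < c3 /\ 0 < c4 /\ 0 < eps0 /\
     forall eps : R, 0 < eps < eps0 ->
       H2 rho (M rho r z eps) /\
       Rbar_le (H2norm rho (M rho r z eps)) c1 /\
       L2norm r (M rho r z eps) <= c2 * eps /\
       c3 * Rpower eps (gamma rho r z) <= Cmod (M rho r z eps z)
         <= c4 * Rpower eps (gamma rho r z))
  /\
  (exists c5 : R, 0 < c5 /\
     forall eps : R, 0 < eps ->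
       exists (U : C -> Prop) (g : C -> C),
         open U /\
         (forall zeta : C, closed_annulus rho zeta -> U zeta) /\
         analytic_on U g /\
         (forall zeta : C, annulus rho zeta -> g zeta = M rho r z eps zeta) /\
         Rbar_le (sup_norm (closed_annulus rho) g) c5).
Proof.
  assert (PP := PI_RGT_0).
  set (a := Cmod z).
  assert (Ha : rho < a < 1) by exact hz.
  assert (Hz0 : z <> 0) by (apply Cmod_gt_0; fold a; lra).
  assert (Hq := dual_bounds rho hrho r hr).
  assert (Hp := dual_bounds rho hrho a Ha).
  destruct (gamma_cases rho r z hrho hr hz hzr) as [Hg Hcase].
  set (g := gamma rho r z) in *; fold a in Hcase.
  destruct (kernel_sum_bounds rho r a g) as (K1 & PK1 & S1 & C1 & Z1); try lra.
  destruct (kernel_sum_bounds rho (rho / r) (rho / a) g) as (K2 & PK2 & S2 & C2 & Z2); try lra.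
  assert (Hin : forall zeta, closed_annulus rho zeta ->
    zeta <> 0 /\ 0 <= a * Cmod zeta <= a /\ 0 <= rho / a * (rho / Cmod zeta) <= rho / a).
  { intros zeta [L1 L2]; split; [apply Cmod_gt_0; lra|].
    assert (0 < rho / Cmod zeta) by (apply Rdiv_lt_0_compat; lra).
    assert (rho / Cmod zeta <= 1).
    { apply Rmult_le_reg_r with (Cmod zeta); [lra|].
      unfold Rdiv; rewrite Rmult_assoc, Rinv_l; lra. }
    split; split; nra. }
  assert (Hsub : forall zeta, annulus rho zeta -> closed_annulus rho zeta).
  { intros zeta [L1 L2]; split; lra. }
  assert (Sup : forall eps zeta, 0 < eps -> closed_annulus rho zeta ->
    Cmod (M rho r z eps zeta) <= 2 * (K1 + K2)).
  { intros eps zeta He Hzeta; destruct (Hin zeta Hzeta) as (N & I1 & I2).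
    apply Cmod_M_le; auto. }
  assert (Diff : forall eps zeta, 0 < eps -> closed_annulus rho zeta -> cdiff (M rho r z eps) zeta).
  { intros eps zeta He Hzeta; destruct (Hin zeta Hzeta) as (N & I1 & I2).
    apply cdiff_M; auto; fold a; lra. }
  assert (Cont : forall eps s t, 0 < eps -> rho < s < 1 -> ccont (M rho r z eps) (circle_point s t)).
  { intros eps s t He Hs; apply cdiff_ccont, Diff; auto; apply Hsub; unfold annulus.
    rewrite Cmod_circle_point; lra. }
  assert (Div : forall e S K, 0 < e -> e * S <= K -> S <= K / e).
  { intros e S K Pe H; apply Rmult_le_reg_l with e; auto.
    replace (e * (K / e)) with K by (field; lra); auto. }
  assert (Hrp : forall e y, 0 < Rpower e y) by (intros; apply Rpower_gt_0).
  split; [|split; [|split]].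
  - exists (6 * PI / rho + (K1 + K2)).
    assert (P0 : 0 < 6 * PI / rho) by (apply Rdiv_lt_0_compat; lra).
    split; [lra|]; intros eps f He [Hf _] Hn HL.
    assert (H1 : forall s, rho < s < 1 -> L2norm s f <= 1).
    { intros s Hs; assert (Q := Rbar_le_trans _ _ _ (H2norm_ge rho f s Hs) Hn); exact Q. }
    (* The kernel bounds are for [eps <= 1]. A larger [eps] is lowered to 1, since the Hardy norm
       already gives [L2norm r f <= 1]. *)
    set (e := Rmin eps 1).
    assert (He1 : 0 < e <= 1) by (split; [apply Rmin_glb_lt; lra|apply Rmin_r]).
    apply Rle_trans with ((6 * PI / rho + (K1 + K2)) * Rpower e g).
    2: { apply Rmult_le_compat_l; [lra|]; apply Rpower_le_base; [|lra].
         split; [lra|apply Rmin_l]. }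
    apply (Hardy_pointwise_bound rho r z f e); auto; try lra.
    + intros zeta Hzeta; apply ex_derive_cdiff, Hf, Hzeta.
    + apply Rmin_glb; auto.
    + intros [|N]; [simpl; specialize (Hrp e g); nra|].
      assert (F1 := Z1 e (a * a) N He1 ltac:(nra)).
      assert (F2 := Z2 e (rho / a * (rho / a)) (S N) He1 ltac:(nra)).
      rewrite sumZ_zlist, Rmult_plus_distr_l, Rmult_plus_distr_r.
      apply Rplus_le_compat.
      * rewrite (sum_n_ext _ (kernel_term rho r e (a * a))); [exact F1|].
        intros n; rewrite (Z_weight_pos rho r), <- pow_powerRZ; fold a.
        unfold kernel_term, weight, Rdiv; rewrite (Rpow_mult_distr a a).
        apply (f_equal2 Rmult); [ring|reflexivity].
      * eapply Rle_trans; [apply Rmult_le_compat_l; [apply Rlt_le, Hrp|]|exact F2].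
        eapply Rle_trans; [|apply sum_n_shift_le, kernel_term_ge_0; [lra|nra]].
        apply Req_le, (sum_n_ext _ (fun n => kernel_term rho (rho / r) e (rho / a * (rho / a)) (S n)));
          intros n.
        rewrite (Z_weight_neg rho r hrho hr), powerRZ_neg', <- pow_powerRZ; fold a.
        assert (W := weight_gt_0 rho (rho / r) e (S n) ltac:(lra)).
        assert (0 < a ^ S n) by (apply pow_lt; lra). assert (0 < rho ^ S n) by (apply pow_lt; lra).
        unfold kernel_term; change ((((rho / r) ^ S n) ^ 2 + e ^ 2 * (1 + (rho ^ S n) ^ 2)))
          with (weight rho (rho / r) e (S n)).
        replace ((rho / a * (rho / a)) ^ S n) with ((rho ^ S n) ^ 2 / (a ^ S n) ^ 2)
          by (unfold Rdiv; rewrite !Rpow_mult_distr, !pow_inv; field; lra).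
        match goal with |- @eq _ ?x ?y => change (@eq R x y) end; field; lra.
  - intros eps zeta He Hzeta; destruct (Hin zeta (Hsub _ Hzeta)) as (N & I1 & I2).
    assert (Pe := Hrp eps (2 - g)).
    destruct (Mterm_summable rho r z hrho hr hz eps zeta
      (K1 / Rpower eps (2 - g)) (K2 / Rpower eps (2 - g))) as [[E1 _] [E2 _]]; auto.
    split; (eapply (ex_series_le (V := C_CompleteNormedModule)); [intros n; apply Rle_refl|]);
      [exact E1|exact E2].
  (* The dominant term lies in the half of the series on the side of [z]; the minimum covers both
     positions. *)
  - set (c3 := Rmin (r ^ 2 / 3) ((rho / r) ^ 2 / 3)).
    assert (P3 : 0 < r ^ 2 / 3) by (assert (0 < r ^ 2) by (apply pow_lt; lra); lra).
    assert (P3' : 0 < (rho / r) ^ 2 / 3) by (assert (0 < (rho / r) ^ 2) by (apply pow_lt; lra); lra).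
    (* The factor 2 comes from [Cmod_CSeries_le], the factor 3 from [L2norm_le_sup]. *)
    exists (3 * (2 * (K1 + K2))), (3 * (2 * (K1 + K2))), c3, (2 * (K1 + K2)), 1.
    split; [lra|]. split; [lra|]. split; [now apply Rmin_glb_lt|]. split; [lra|]. split; [lra|].
    intros eps He.
    assert (Hn : Rbar_le (H2norm rho (M rho r z eps)) (3 * (2 * (K1 + K2)))).
    { apply Lub_Rbar_correct; intros x [s [Hs ->]].
      apply L2norm_le_sup; try lra; [intros; apply Cont; lra|].
      intros t; apply Sup; [lra|]; apply Hsub; unfold annulus.
      rewrite Cmod_circle_point; lra. }
    split; [split|split; [exact Hn|split; [|split]]].
    + intros zeta Hzeta; apply ex_derive_cdiff, Diff; [lra|now apply Hsub].
    + eapply Rbar_le_lt_trans; [exact Hn|exact I].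
    + rewrite Rmult_assoc; apply L2norm_le_sup; [lra|nra|intros; apply Cont; lra|].
      intros t; assert (Ec : Cmod (circle_point r t) = r) by (apply Cmod_circle_point; lra).
      replace (2 * (K1 + K2) * eps) with (2 * (K1 * eps + K2 * eps)) by ring.
      apply Cmod_M_le; auto; try lra.
      * apply Cmod_gt_0; lra.
      * intros N; rewrite Ec; apply C1; [lra|]; fold a; nra.
      * intros N; rewrite Ec; apply C2; [lra|]; fold a; nra.
    + assert (T := M_at_z_ge_term rho r z hrho hr hz eps
        (K1 * Rpower eps g / Rpower eps (2 - g)) (K2 * Rpower eps g / Rpower eps (2 - g))
        ltac:(lra)
        (fun N => Div _ _ _ (Hrp _ _) (Z1 eps (a * a) N ltac:(lra) ltac:(nra)))
        (fun N => Div _ _ _ (Hrp _ _) (Z2 eps (rho / a * (rho / a)) N ltac:(lra) ltac:(nra)))).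
      fold a g in T; destruct Hcase as [[E _]|[_ E]].
      * destruct (kernel_term_lower rho r g eps) as [n L]; try lra.
        rewrite <- E in L; eapply Rle_trans; [|apply (proj1 (T (S n)))]; eapply Rle_trans; [|exact L].
        apply Rmult_le_compat_r; [apply Rlt_le, Hrp|apply Rmin_l].
      * destruct (kernel_term_lower rho (rho / r) g eps) as [n L]; try lra.
        rewrite <- E in L; eapply Rle_trans; [|apply (proj2 (T n))]; eapply Rle_trans; [|exact L].
        apply Rmult_le_compat_r; [apply Rlt_le, Hrp|apply Rmin_r].
    + replace (2 * (K1 + K2) * Rpower eps g) with (2 * (K1 * Rpower eps g + K2 * Rpower eps g)) by ring.
      apply Cmod_M_le; auto; try lra; intros N; [apply Z1|apply Z2]; fold a; lra || nra.
  - exists (2 * (K1 + K2)); split; [lra|]; intros eps He.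
    (* The open annulus on which both halves converge; since [rho < a < 1], it contains the closed
       one, and the series itself is the extension. *)
    exists (fun zeta => rho * (rho / a) < Cmod zeta < / a), (M rho r z eps).
    assert (Pa : 1 < / a) by (rewrite <- Rinv_1; apply Rinv_lt_contravar; lra).
    split; [apply open_Cmod_interval|split; [|split; [|split]]].
    + intros zeta [L1 L2]; split; [nra|lra].
    + intros zeta [L1 L2]; apply ex_derive_cdiff.
      assert (L0 : 0 < Cmod zeta) by nra.
      apply cdiff_M; auto; fold a.
      * now apply Cmod_gt_0.
      * apply Rmult_lt_reg_l with (/ a); [lra|]; rewrite <- Rmult_assoc, Rinv_l; lra.
      * apply Rmult_lt_reg_r with (Cmod zeta); auto.
        replace (rho / a * (rho / Cmod zeta) * Cmod zeta) with (rho * (rho / a)) by (field; lra); lra.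
    + reflexivity.
    + apply Lub_Rbar_correct; intros x [zeta [Hzeta ->]]; now apply Sup.
Qed.
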